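(* Let $\mathcal{N}_{A'B'\to AB}$ be a bipartite quantum channel that is bidirectional teleportation-simulable with associated resource state $\theta_{L_AL_B}$ and that is resource-seizable (with respect to this $\theta_{L_AL_B}$). Then its sequential entanglement cost equals the entanglement cost of the resource state: $$E_C(\mathcal{N}_{A'B'\to AB}) = E_C(\theta_{L_AL_B}),$$ where on the right-hand side $E_C(\theta_{L_AL_B})$ is the standard (asymptotic, approximate, LOCC) entanglement cost of the bipartite state $\theta_{L_AL_B}$.
   Context: A bipartite channel $\mathcal{N}_{A'B'\to AB}$ has Alice holding $A',A$ and Bob holding $B',B$. It is bidirectional teleportation-simulable with associated resource state $\theta_{L_AL_B}$ if for all input states $\rho_{A'B'}$ one has $\mathcal{N}_{A'B'\to AB}(\rho_{A'B'})=\mathcal{L}_{L_AA'B'L_B\to AB}(\rho_{A'B'}\otimes\theta_{L_AL_B})$ for some LOCC channel $\mathcal{L}$ with respect to the cut $L_AA':L_BB'$. It is resource-seizable if moreover there exist a separable state $\rho_{A_MA'B'B_M}$ (separable with respect to $A_MA':B'B_M$) and an LOCC channel $\mathcal{D}_{A_MABB_M\to L_AL_B}$ (with respect to $A_MA:BB_M$) such that $\mathcal{D}(\mathcal{N}_{A'B'\to AB}(\rho_{A_MA'B'B_M}))=\theta_{L_AL_B}$. Sequential entanglement cost: For $n,M\in\mathbb{N}$, $\varepsilon\in[0,1]$, an $(n,M,\varepsilon)$ sequential LOCC-assisted simulation code for $\mathcal{N}$ consists of a maximally entangled state $\Phi_{\bar A_0\bar B_0}$ of Schmidt rank $M$ and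 LOCC channels $\mathcal{L}^{(i)}_{A_i'B_i'\bar A_{i-1}\bar B_{i-1}\to A_iB_i\bar A_i\bar B_i}$, $i=1,\dots,n$ (Alice holds all $A$-labelled systems, Bob all $B$-labelled ones). A sequential discrimination strategy consists of an initial state $\rho_{R_1A_1'B_1'}$, channels $\mathcal{A}^{(i)}_{R_iA_iB_i\to R_{i+1}A'_{i+1}B'_{i+1}}$ for $i=1,\dots,n-1$, and a final two-outcome measurement. Applied to $n$ uses of $\mathcal{N}$ it gives a final state $\rho_{R_nA_nB_n}$ (alternating $\mathcal{N}_{A_i'B_i'\to A_iB_i}$ and $\mathcal{A}^{(i)}$); applied to the simulation it gives $\tau_{R_nA_nB_n}$ (replacing the $i$-th channel use by $\mathcal{L}^{(i)}$, with the memory systems $\bar A_i\bar B_i$ carried forward, starting from $\Phi_{\bar A_0\bar B_0}$, and tracing out final memory). The code is an $(n,M,\varepsilon)$ code if $\frac12\sup\|\rho_{R_nA_nB_n}-\tau_{R_nA_nB_n}\|_1\le\varepsilon$, the supremum over all sequential discrimination strategies. A rate $R$ is achievable if for all $\varepsilon\in(0,1]$, $\delta>0$ and all sufficiently large $n$ there exists an $(n,2^{n(R+\delta)},\varepsilon)$ code; $E_C(\mathcal{N})$ is the infimum of achievable rates. *)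

(* Defs.v *)
(* MathComp + real_closed (complex numbers R[i], tensmx)
   + MathComp-Analysis (realType, powR, ereal_inf). *)
From HB Require Import structures.
From mathcomp Require Import all_boot all_order all_algebra.
From mathcomp Require Import complex mxtens.
From mathcomp Require Import boolp classical_sets reals constructive_ereal ereal exp.

Set Implicit Arguments.
Unset Strict Implicit.
Unset Printing Implicit Defensive.

Import Order.TTheory GRing.Theory Num.Theory.
Local Open Scope ring_scope.

Section Quantum.

Variable R : realType.
Local Notation C := (R[i]).

(* Index bookkeeping for tensor products: 'I_(m*n) ~ 'I_m * 'I_n,     *)
(* compatible with mxtens.tensmx (A *t B).                             *)
Definition ix {m n} (i : 'I_m) (j : 'I_n) : 'I_(m * n) := mxtens_index (i, j).
Definition fstI {m n} (k : 'I_(m * n)) : 'I_m := (mxtens_unindex k).1.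
Definition sndI {m n} (k : 'I_(m * n)) : 'I_n := (mxtens_unindex k).2.

(* Basic quantum notions on C^n.                                      *)
Definition adjmx {m n} (A : 'M[C]_(m, n)) : 'M[C]_(n, m) :=
  (map_mx (fun x => x^*) A)^T.

(* positive semidefinite (over C this implies Hermitian) *)
Definition psd {n} (A : 'M[C]_n) : Prop :=
  forall v : 'cV[C]_n, 0 <= (adjmx v *m A *m v) 0 0.

(* density operator *)
Definition state {n} (A : 'M[C]_n) : Prop := psd A /\ \tr A = 1.

(* trace norm ||X||_1 = Tr sqrt(X^dagger X) *)
Definition trnorm {n} (X : 'M[C]_n) : R :=
  complex.Re (\tr (xget 0 [set P : 'M[C]_n | psd P /\ P *m P = adjmx X *m X])).

(* linear maps between matrix spaces *)
Definition mapT (m n : nat) := 'M[C]_m -> 'M[C]_n.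

Definition linmap {m n} (F : mapT m n) : Prop :=
  forall (a : C) X Y, F (a *: X + Y) = a *: F X + F Y.

(* id_k (x) F *)
Definition idten (k : nat) {m n} (F : mapT m n) (X : 'M[C]_(k * m)) : 'M[C]_(k * n) :=
  \matrix_(i, j) \sum_(x < m) \sum_(y < m)
     X (ix (fstI i) x) (ix (fstI j) y) * F (delta_mx x y) (sndI i) (sndI j).
Arguments idten k {m n} F X.

Definition cp {m n} (F : mapT m n) : Prop :=
  linmap F /\ forall k (X : 'M[C]_(k * m)), psd X -> psd (idten k F X).

Definition tp {m n} (F : mapT m n) : Prop := forall X, \tr (F X) = \tr X.

(* quantum channel *)
Definition cptp {m n} (F : mapT m n) : Prop := cp F /\ tp F.

(* E (x) F acting on a bipartite system X (x) Y *)
Definition mapten {x x' y y'} (E : mapT x x') (F : mapT y y')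
  (X : 'M[C]_(x * y)) : 'M[C]_(x' * y') :=
  \matrix_(i, j) \sum_(a < x) \sum_(a' < x) \sum_(b < y) \sum_(b' < y)
     X (ix a b) (ix a' b') * E (delta_mx a a') (fstI i) (fstI j)
                           * F (delta_mx b b') (sndI i) (sndI j).

(* a quantum instrument with k outcomes *)
Definition instrument {m n k} (E : 'I_k -> mapT m n) : Prop :=
  (forall j, cp (E j)) /\ forall X, \tr (\sum_(j < k) E j X) = \tr X.

(* LOCC (finitely many rounds) for the bipartite cut x : y.           *)
(* locc_instr x y x' y' k M : M is an LOCC instrument with k outcomes *)
(* from the bipartite system (x : y) to (x' : y').                     *)
Inductive locc_instr : forall (x y x' y' k : nat),
    ('I_k -> mapT (x * y) (x' * y')) -> Prop :=
| li_alice x y x' k (E : 'I_k -> mapT x x') :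
    instrument E -> @locc_instr x y x' y k (fun j => mapten (E j) id)
| li_bob x y y' k (F : 'I_k -> mapT y y') :
    instrument F -> @locc_instr x y x y' k (fun j => mapten id (F j))
| li_comp x y x1 y1 x2 y2 k k' (M : 'I_k -> mapT (x * y) (x1 * y1))
    (Nf : 'I_k -> 'I_k' -> mapT (x1 * y1) (x2 * y2)) :
    @locc_instr x y x1 y1 k M ->
    (forall j, @locc_instr x1 y1 x2 y2 k' (Nf j)) ->
    @locc_instr x y x2 y2 (k * k')
      (fun l => fun X => Nf (fstI l) (sndI l) (M (fstI l) X))
| li_coarse x y x' y' k k' (M : 'I_k -> mapT (x * y) (x' * y')) (f : 'I_k -> 'I_k') :
    @locc_instr x y x' y' k M ->
    @locc_instr x y x' y' k' (fun i X => \sum_(j < k | f j == i) M j X).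

(* LOCC channel from (x : y) to (x' : y') *)
Definition locc (x y x' y' : nat) (L : mapT (x * y) (x' * y')) : Prop :=
  exists k (M : 'I_k -> mapT (x * y) (x' * y')),
    locc_instr M /\ forall X, L X = \sum_(j < k) M j X.

(* separable state w.r.t. the cut x : y *)
Definition separable {x y} (rho : 'M[C]_(x * y)) : Prop :=
  exists k (p : 'I_k -> R) (s : 'I_k -> 'M[C]_x) (w : 'I_k -> 'M[C]_y),
    (forall j, 0 <= p j) /\ \sum_(j < k) p j = 1 /\
    (forall j, state (s j)) /\ (forall j, state (w j)) /\
    rho = \sum_(j < k) ((p j)%:C)%C *: (s j *t w j).

(* maximally entangled state of Schmidt rank M on M (x) M *)
Definition maxent (M : nat) : 'M[C]_(M * M) :=
  \matrix_(i, j) (if (fstI i == sndI i) && (fstI j == sndI j)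
                  then (M%:R)^-1 else 0).

(* X_{A1 B1} (x) Y_{A2 B2}, regrouped as (A1 A2) : (B1 B2) *)
Definition bten {a1 b1 a2 b2} (X : 'M[C]_(a1 * b1)) (Y : 'M[C]_(a2 * b2))
  : 'M[C]_((a1 * a2) * (b1 * b2)) :=
  \matrix_(i, j)
    (X (ix (fstI (fstI i)) (fstI (sndI i))) (ix (fstI (fstI j)) (fstI (sndI j)))
   * Y (ix (sndI (fstI i)) (sndI (sndI i))) (ix (sndI (fstI j)) (sndI (sndI j)))).

(* id_{A_M} (x) N_{A'B' -> AB} (x) id_{B_M}, on (A_M A') : (B' B_M) *)
Definition apply_mid {am bm a' b' a b} (N : mapT (a' * b') (a * b))
  (X : 'M[C]_((am * a') * (b' * bm))) : 'M[C]_((am * a) * (b * bm)) :=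
  \matrix_(i, j) \sum_(y < a') \sum_(y' < a') \sum_(z < b') \sum_(z' < b')
     X (ix (ix (fstI (fstI i)) y) (ix z (sndI (sndI i))))
       (ix (ix (fstI (fstI j)) y') (ix z' (sndI (sndI j))))
   * N (delta_mx (ix y z) (ix y' z'))
       (ix (sndI (fstI i)) (fstI (sndI i))) (ix (sndI (fstI j)) (fstI (sndI j))).

(* n-fold tensor power of a bipartite state, Alice's copies grouped together *)
Fixpoint pdim (d n : nat) : nat := if n is n'.+1 then pdim d n' * d else 1.

Fixpoint tpow {la lb} (th : 'M[C]_(la * lb)) (n : nat) : 'M[C]_(pdim la n * pdim lb n) :=
  match n return 'M[C]_(pdim la n * pdim lb n) with
  | 0 => const_mx 1
  | n'.+1 => bten (tpow th n') th
  end.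

(* Channel properties from the paper.                                 *)
Definition tele_simulable {a' b' a b la lb} (N : mapT (a' * b') (a * b))
  (th : 'M[C]_(la * lb)) : Prop :=
  exists L : mapT ((la * a') * (lb * b')) (a * b),
    locc L /\ forall rho : 'M[C]_(a' * b'), state rho -> N rho = L (bten th rho).

Definition resource_seizable {a' b' a b la lb} (N : mapT (a' * b') (a * b))
  (th : 'M[C]_(la * lb)) : Prop :=
  exists am bm (rho : 'M[C]_((am * a') * (b' * bm)))
         (D : mapT ((am * a) * (b * bm)) (la * lb)),
    separable rho /\ locc D /\ D (apply_mid N rho) = th.

(* Sequential simulation codes and discrimination strategies.         *)

(* memory dimensions: step 0 is the initial maximally entangled state *)
Definition mdim (M : nat) (f : nat -> nat) (i : nat) : nat :=
  if i is 0 then M else f i.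

(* reference (x) ((A' x mA) : (B' x mB))  from  rho_{R A'B'} and Phi *)
Definition attach {r a' b' m1 m2} (rho : 'M[C]_(r * (a' * b'))) (Phi : 'M[C]_(m1 * m2))
  : 'M[C]_(r * ((a' * m1) * (b' * m2))) :=
  \matrix_(i, j)
    (rho (ix (fstI i) (ix (fstI (fstI (sndI i))) (fstI (sndI (sndI i)))))
         (ix (fstI j) (ix (fstI (fstI (sndI j))) (fstI (sndI (sndI j)))))
   * Phi (ix (sndI (fstI (sndI i))) (sndI (sndI (sndI i))))
         (ix (sndI (fstI (sndI j))) (sndI (sndI (sndI j))))).

(* apply a channel  R A B -> R' A' B'  leaving the memory systems untouched *)
Definition apply_mem {r r' a b a' b' m1 m2}
  (F : mapT (r * (a * b)) (r' * (a' * b'))) (X : 'M[C]_(r * ((a * m1) * (b * m2))))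
  : 'M[C]_(r' * ((a' * m1) * (b' * m2))) :=
  \matrix_(i, j) \sum_(x < r) \sum_(x' < r) \sum_(y < a) \sum_(y' < a)
                 \sum_(z < b) \sum_(z' < b)
     X (ix x (ix (ix y (sndI (fstI (sndI i)))) (ix z (sndI (sndI (sndI i))))))
       (ix x' (ix (ix y' (sndI (fstI (sndI j)))) (ix z' (sndI (sndI (sndI j))))))
   * F (delta_mx (ix x (ix y z)) (ix x' (ix y' z')))
       (ix (fstI i) (ix (fstI (fstI (sndI i))) (fstI (sndI (sndI i)))))
       (ix (fstI j) (ix (fstI (fstI (sndI j))) (fstI (sndI (sndI j))))).

(* trace out the memory systems *)
Definition trmem {r a b m1 m2} (X : 'M[C]_(r * ((a * m1) * (b * m2))))
  : 'M[C]_(r * (a * b)) :=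
  \matrix_(i, j) \sum_(u < m1) \sum_(v < m2)
     X (ix (fstI i) (ix (ix (fstI (sndI i)) u) (ix (sndI (sndI i)) v)))
       (ix (fstI j) (ix (ix (fstI (sndI j)) u) (ix (sndI (sndI j)) v))).

(* State after the (k+1)-th use of N in a sequential strategy
   (index k = 0 is the first channel use). *)
Fixpoint real_st {a' b' a b} (N : mapT (a' * b') (a * b)) (r : nat -> nat)
  (rho0 : 'M[C]_(r 0 * (a' * b')))
  (Adv : forall k, mapT (r k * (a * b)) (r k.+1 * (a' * b'))) (k : nat)
  : 'M[C]_(r k * (a * b)) :=
  match k return 'M[C]_(r k * (a * b)) with
  | 0 => idten (r 0) N rho0
  | k'.+1 => idten (r k'.+1) N (Adv k' (real_st N rho0 Adv k'))
  end.

(* Same, with the (k+1)-th channel use replaced by L k (paper's L^(k+1)),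
   memory systems carried along. *)
Fixpoint sim_st {a' b' a b} (M : nat) (ma mb : nat -> nat)
  (L : forall i, mapT ((a' * mdim M ma i) * (b' * mdim M mb i))
                      ((a * mdim M ma i.+1) * (b * mdim M mb i.+1)))
  (r : nat -> nat) (rho0 : 'M[C]_(r 0 * (a' * b')))
  (Adv : forall k, mapT (r k * (a * b)) (r k.+1 * (a' * b'))) (k : nat)
  : 'M[C]_(r k * ((a * mdim M ma k.+1) * (b * mdim M mb k.+1))) :=
  match k return 'M[C]_(r k * ((a * mdim M ma k.+1) * (b * mdim M mb k.+1))) with
  | 0 => idten (r 0) (L 0) (attach rho0 (maxent M))
  | k'.+1 => idten (r k'.+1) (L k'.+1) (apply_mem (Adv k') (sim_st L rho0 Adv k'))
  end.

(* (n, M, eps) sequential LOCC-assisted simulation code for N (n >= 1) *)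
Definition seq_code {a' b' a b} (N : mapT (a' * b') (a * b)) (n M : nat) (eps : R)
  : Prop :=
  (0 < M)%N /\
  exists (ma mb : nat -> nat)
         (L : forall i, mapT ((a' * mdim M ma i) * (b' * mdim M mb i))
                             ((a * mdim M ma i.+1) * (b * mdim M mb i.+1))),
    (forall i, (i < n)%N -> locc (L i)) /\
    forall (r : nat -> nat) (rho0 : 'M[C]_(r 0 * (a' * b')))
           (Adv : forall k, mapT (r k * (a * b)) (r k.+1 * (a' * b'))),
      state rho0 -> (forall k, (k < n.-1)%N -> cptp (Adv k)) ->
      trnorm (real_st N rho0 Adv n.-1 - trmem (sim_st L rho0 Adv n.-1)) / 2 <= eps.

Definition achievable_channel {a' b' a b} (N : mapT (a' * b') (a * b)) (rt : R) : Prop :=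
  forall eps : R, 0 < eps <= 1 -> forall delta : R, 0 < delta ->
  exists n0 : nat, forall n : nat, (n0 <= n)%N -> (0 < n)%N ->
    exists M : nat, M%:R <= 2 `^ (n%:R * (rt + delta)) /\ seq_code N n M eps.

Definition EC_channel {a' b' a b} (N : mapT (a' * b') (a * b)) : \bar R :=
  ereal_inf [set (rt%:E)%E | rt in [set rt | achievable_channel N rt]].

(* standard entanglement cost of a bipartite state *)
Definition achievable_state {la lb} (th : 'M[C]_(la * lb)) (rt : R) : Prop :=
  forall eps : R, 0 < eps <= 1 -> forall delta : R, 0 < delta ->
  exists n0 : nat, forall n : nat, (n0 <= n)%N ->
    exists M : nat, (0 < M)%N /\ M%:R <= 2 `^ (n%:R * (rt + delta)) /\
    exists Lam : mapT (M * M) (pdim la n * pdim lb n),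
      locc Lam /\ trnorm (Lam (maxent M) - tpow th n) / 2 <= eps.

Definition EC_state {la lb} (th : 'M[C]_(la * lb)) : \bar R :=
  ereal_inf [set (rt%:E)%E | rt in [set rt | achievable_state th rt]].

End Quantum.

(* Main.v *)
(* Both sides are infima of sets of rates, and these sets coincide.

   From a state code to a channel code: turn the maximally entangled state into
   an approximation of theta^n once and for all, then simulate the i-th channel
   use by the teleportation protocol on the i-th copy. With exactly theta^n the
   simulation would be perfect, and every strategy applied to this simulation
   is a positive trace-preserving linear map of the resource, so it cannot
   increase the trace distance between the approximation and theta^n.

   From a channel code to a state code: let the adversary feed the seizing probe
   into the channel, extract theta with the seizing protocol, store it and start
   again. Against the true channel it ends up with theta^n; against the
   simulation all that happens is LOCC on the maximally entangled state, because
   separable probes can be prepared by LOCC. *)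
Require Import Defs.
From HB Require Import structures.
From mathcomp Require Import all_boot all_order all_algebra.
From mathcomp Require Import complex mxtens spectral sesquilinear.
From mathcomp Require Import boolp classical_sets reals constructive_ereal ereal exp.

Set Implicit Arguments.
Unset Strict Implicit.
Unset Printing Implicit Defensive.

Import Order.TTheory GRing.Theory Num.Theory.
Local Open Scope ring_scope.

(* Over an abstract field because, over R[i], conversion unfolds the inverse of
   complex numbers and the last step takes minutes. *)
Lemma hermitian_unitary_diag (K : numClosedFieldType) n (X : 'M[K]_n) :
  (map_mx Num.conj X)^T = X ->
  exists (U : 'M[K]_n) (d : 'rV[K]_n), [/\ U *m (map_mx Num.conj U)^T = 1%:M,
    (map_mx Num.conj U)^T *m U = 1%:M, forall i, d 0 i \is Num.real
    & X = (map_mx Num.conj U)^T *m diag_mx d *m U].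
Proof.
move=> hX.
have hh : X \is hermsymmx.
  by rewrite is_hermitianmxE expr0 scale1r -map_trmx -[X in X == _]hX.
exists (spectralmx X), (spectral_diag X).
have /unitarymxP := spectral_unitarymx X; rewrite -map_trmx => hU.
split=> //; first exact: mulmx1C.
  by move=> i; have /mxOverP := hermitian_spectral_diag_real hh; apply.
have /hermitian_normalmx/orthomx_spectralP := hh.
by rewrite invmx_unitary ?spectral_unitarymx // -map_trmx.
Qed.

(** * Positive matrices and the trace norm *)

Section Spectral.

Variable R : realType.
Local Notation C := (R[i]).

Lemma adjmxE m n (A : 'M[C]_(m, n)) i j : adjmx A i j = (A j i)^*.
Proof. by rewrite /adjmx !mxE. Qed.

Lemma adjmxK m n (A : 'M[C]_(m, n)) : adjmx (adjmx A) = A.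
Proof. by apply/matrixP=> i j; rewrite !adjmxE conjCK. Qed.

Lemma adjmxM m n p (A : 'M[C]_(m, n)) (B : 'M[C]_(n, p)) :
  adjmx (A *m B) = adjmx B *m adjmx A.
Proof. by rewrite /adjmx map_mxM trmx_mul. Qed.

Lemma adjmxD m n (A B : 'M[C]_(m, n)) : adjmx (A + B) = adjmx A + adjmx B.
Proof. by rewrite /adjmx map_mxD linearD. Qed.

Lemma adjmxB m n (A B : 'M[C]_(m, n)) : adjmx (A - B) = adjmx A - adjmx B.
Proof. by rewrite /adjmx map_mxB linearB. Qed.

Lemma adjmxZ m n c (A : 'M[C]_(m, n)) : adjmx (c *: A) = c^* *: adjmx A.
Proof. by apply/matrixP=> i j; rewrite !(adjmxE, mxE) rmorphM. Qed.

Lemma mxEB m n (A B : 'M[C]_(m, n)) i j : (A - B) i j = A i j - B i j.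
Proof. by rewrite !mxE. Qed.

Lemma mxED m n (A B : 'M[C]_(m, n)) i j : (A + B) i j = A i j + B i j.
Proof. by rewrite mxE. Qed.

Lemma mxEZ m n c (A : 'M[C]_(m, n)) i j : (c *: A) i j = c * A i j.
Proof. by rewrite mxE. Qed.

Lemma psd0 n : psd (0 : 'M[C]_n).
Proof. by move=> v; rewrite mulmx0 mul0mx mxE. Qed.

Lemma psdD n (A B : 'M[C]_n) : psd A -> psd B -> psd (A + B).
Proof. by move=> hA hB v; rewrite mulmxDr mulmxDl mxE addr_ge0. Qed.

Lemma psd_sum n I (r : seq I) (P : pred I) (A : I -> 'M[C]_n) :
  (forall i, P i -> psd (A i)) -> psd (\sum_(i <- r | P i) A i).
Proof. by move=> hA; apply: (big_ind (@psd R n)); [apply: psd0|apply: psdD|]. Qed.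

Lemma psdZ n c (A : 'M[C]_n) : 0 <= c -> psd A -> psd (c *: A).
Proof. by move=> hc hA v; rewrite -scalemxAr -scalemxAl mxE mulr_ge0. Qed.

Lemma psd_conj m n (A : 'M[C]_n) (B : 'M[C]_(n, m)) :
  psd A -> psd (adjmx B *m A *m B).
Proof. by move=> hA v; rewrite !mulmxA -adjmxM -!mulmxA mulmxA; apply: hA. Qed.

Lemma psd1 n : psd (1%:M : 'M[C]_n).
Proof.
move=> v; rewrite mulmx1 mxE sumr_ge0 // => i _.
by rewrite adjmxE mulrC -normCK exprn_ge0.
Qed.

Lemma psd_gram m n (B : 'M[C]_(n, m)) : psd (adjmx B *m B).
Proof. by rewrite -[adjmx B]mulmx1; apply/psd_conj/psd1. Qed.

Lemma mulmx_delta_entry m n (B : 'M[C]_(m, n)) i j :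
  (adjmx (delta_mx i (0 : 'I_1)) *m B *m delta_mx j (0 : 'I_1)) 0 0 = B i j.
Proof.
have -> : adjmx (delta_mx i (0 : 'I_1)) = delta_mx 0 i :> 'M[C]_(_, _).
  by apply/matrixP=> a b; rewrite adjmxE !mxE andbC rmorph_nat.
by rewrite -rowE -colE !mxE.
Qed.

(** The numbers [adjmx v *m A *m v] are nonnegative, hence real, so the quadratic form of
    [A - adjmx A] vanishes identically; over complex scalars this forces the matrix itself to
    vanish. *)
Lemma psd_herm n (A : 'M[C]_n) : psd A -> adjmx A = A.
Proof.
move=> hA; pose B := A - adjmx A.
suff B0 : B = 0 by apply/esym/eqP; rewrite -subr_eq0 -/B B0.
have Bq (v : 'cV[C]_n) : (adjmx v *m B *m v) 0 0 = 0.
  have <- : (adjmx v *m A *m v) 0 0 - (adjmx (adjmx v *m A *m v)) 0 0 = 0.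
    rewrite adjmxE; apply/eqP; rewrite subr_eq0 eq_sym; apply/eqP/CrealP.
    exact: ger0_real (hA v).
  by rewrite !adjmxM adjmxK mulmxBr mulmxBl mulmxA mxEB.
clearbody B => {hA}.
have Bd i : B i i = 0 by rewrite -(Bq (delta_mx i 0)) mulmx_delta_entry.
(* Polarisation: only the cross terms survive at [e_i + c e_j]. Taking [c = 1] and [c = 'i] then
   isolates [B i j]. *)
have Bc i j c : c * B i j + c^* * B j i = 0.
  have := Bq (delta_mx i 0 + c *: delta_mx j 0).
  rewrite adjmxD adjmxZ !mulmxDl !mulmxDr -!scalemxAl -!scalemxAr.
  by rewrite !mxED !mxEZ !mulmx_delta_entry !Bd !mulr0 addr0 add0r.
apply/matrixP=> i j; rewrite [RHS]mxE.
have h1 := Bc i j 1; have hi := Bc i j 'i.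
rewrite rmorph1 !mul1r in h1.
rewrite conjCi mulNr -mulrBr in hi.
move/eqP: hi; rewrite mulf_eq0 (negPf (neq0Ci _)) /= subr_eq0 => /eqP hi.
by move/eqP: h1; rewrite -hi -mulr2n mulrn_eq0 /= => /eqP.
Qed.

Lemma herm_spectral n (X : 'M[C]_n) : adjmx X = X ->
  exists (U : 'M[C]_n) (d : 'rV[C]_n), [/\ U *m adjmx U = 1%:M,
    adjmx U *m U = 1%:M, forall i, d 0 i \is Num.real
    & X = adjmx U *m diag_mx d *m U].
Proof. exact: hermitian_unitary_diag. Qed.

Lemma psd_diag_conj n (U : 'M[C]_n) (d : 'rV[C]_n) :
  (forall i, 0 <= d 0 i) -> psd (adjmx U *m diag_mx d *m U).
Proof.
move=> hd; apply: psd_conj => v; rewrite -mulmxA mxE sumr_ge0 // => i _.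
by rewrite adjmxE mul_diag_mx mxE mulrCA mulr_ge0 // mulrC -normCK exprn_ge0.
Qed.

Lemma psd_diag_ge0 n (A : 'M[C]_n) i : psd A -> 0 <= A i i.
Proof. by move=> hA; rewrite -mulmx_delta_entry. Qed.

Lemma psd_spectral n (X : 'M[C]_n) : psd X ->
  exists (U : 'M[C]_n) (d : 'rV[C]_n), [/\ U *m adjmx U = 1%:M,
    adjmx U *m U = 1%:M, forall i, 0 <= d 0 i
    & X = adjmx U *m diag_mx d *m U].
Proof.
move=> hX; have [U [d [h1 h2 _ eX]]] := herm_spectral (psd_herm hX).
exists U, d; split=> // i.
have -> : d 0 i = (U *m X *m adjmx U) i i.
  by rewrite eX !mulmxA h1 mul1mx -mulmxA h1 mulmx1 mxE eqxx.
by apply: psd_diag_ge0; rewrite -{1}[U]adjmxK; apply: psd_conj.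
Qed.

Lemma mxtrace_diag_conj n (U : 'M[C]_n) (d : 'rV[C]_n) :
  U *m adjmx U = 1%:M -> \tr (adjmx U *m diag_mx d *m U) = \sum_i d 0 i.
Proof. by move=> hU; rewrite mxtrace_mulC mulmxA hU mul1mx mxtrace_diag. Qed.

Lemma psd_trace_ge0 n (A : 'M[C]_n) : psd A -> 0 <= \tr A.
Proof. by move=> hA; apply: sumr_ge0 => i _; apply: psd_diag_ge0. Qed.

Lemma psd_trace0 n (A : 'M[C]_n) : psd A -> \tr A = 0 -> A = 0.
Proof.
move=> hA; have [U [d [h1 _ hd ->]]] := psd_spectral hA.
rewrite mxtrace_diag_conj // => /eqP; rewrite psumr_eq0 // => /allP d0.
suff -> : d = 0 by rewrite raddf0 mulmx0 mul0mx.
by apply/rowP=> i; rewrite mxE; apply/eqP/(implyP (d0 i _)); rewrite ?mem_index_enum.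
Qed.

Lemma psd_factor n (A : 'M[C]_n) : psd A -> exists B : 'M[C]_n, A = adjmx B *m B.
Proof.
move=> hA; have [U [d [_ _ hd ->]]] := psd_spectral hA.
pose s := \row_i sqrtC (d 0 i).
exists (diag_mx s *m U).
transitivity (adjmx U *m (adjmx (diag_mx s) *m diag_mx s) *m U); last first.
  by rewrite adjmxM !mulmxA.
congr (_ *m _ *m _); apply/matrixP=> i j; rewrite mul_mx_diag mxE adjmxE !mxE.
rewrite eq_sym; case: eqP => [->|_]; last by rewrite !mulr0n conjC0 mul0r.
rewrite !mulr1n; have /CrealP -> : sqrtC (d 0 i) \is Num.real.
  by rewrite ger0_real // sqrtC_ge0.
by rewrite -expr2 sqrtCK.
Qed.

(* With D := P - Q, P^2 = Q^2 gives P D = - D Q, so D P D and D Q D are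
   positive with opposite traces: both vanish, hence D^3 = 0. *)
Lemma psd_sqr_inj n (P Q : 'M[C]_n) : psd P -> psd Q -> P *m P = Q *m Q -> P = Q.
Proof.
move=> hP hQ e; set D := P - Q.
have hD : adjmx D = D by rewrite adjmxB !psd_herm.
have e1 : P *m D = - (D *m Q).
  by rewrite /D mulmxBr mulmxBl e opprB.
have p1 : psd (D *m P *m D) by rewrite -{1}hD; apply: psd_conj.
have p2 : psd (D *m Q *m D) by rewrite -{1}hD; apply: psd_conj.
have et : \tr (D *m P *m D) = - \tr (D *m Q *m D).
  by rewrite -mulmxA e1 mulmxN raddfN /= mulmxA -mulmxA mxtrace_mulC.
have t2 : \tr (D *m Q *m D) = 0.
  apply/eqP; rewrite eq_le psd_trace_ge0 // andbT -oppr_ge0 -et.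
  exact: psd_trace_ge0.
have t1 : \tr (D *m P *m D) = 0 by rewrite et t2 oppr0.
have D3 : D *m D *m D = 0.
  have -> : D *m D *m D = D *m P *m D - D *m Q *m D by rewrite -mulmxBl -mulmxBr.
  by rewrite (psd_trace0 p1 t1) (psd_trace0 p2 t2) subr0.
have gram0 (A : 'M[C]_n) : adjmx A *m A = 0 -> A = 0.
  move=> /(congr1 mxtrace) /eqP; rewrite raddf0 /mxtrace psumr_eq0; last first.
    by move=> i _; apply/psd_diag_ge0/psd_gram.
  move=> /allP h; apply/matrixP=> i j; rewrite [RHS]mxE; apply/eqP.
  have := implyP (h j (mem_index_enum _)) isT.
  rewrite mxE psumr_eq0 => [/allP/(_ i (mem_index_enum _))/=|k _].
    by rewrite adjmxE mulrC -normCK expf_eq0 /= normr_eq0.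
  by rewrite adjmxE mulrC -normCK exprn_ge0.
(* [D] is Hermitian, so the Gram matrix of [D *m D] is [D^4 = 0]; afterwards that of [D] is
   [D^2 = 0]. *)
have D2 : D *m D = 0.
  by apply: gram0; rewrite adjmxM hD mulmxA D3 mul0mx.
by apply/eqP; rewrite -subr_eq0 -/D; apply/eqP/gram0; rewrite hD.
Qed.

(** [trnorm] takes a chosen positive root of [adjmx X *m X]. The matrix with eigenvalues [|d_i|] in
    the same basis is such a root, and by [psd_sqr_inj] it is the only one. *)
Lemma trnorm_spectral n (X U : 'M[C]_n) (d : 'rV[C]_n) :
  U *m adjmx U = 1%:M -> (forall i, d 0 i \is Num.real) ->
  X = adjmx U *m diag_mx d *m U -> ((trnorm X)%:C)%C = \sum_i `|d 0 i|.
Proof.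
move=> hU hd eX; pose e : 'rV[C]_n := \row_i `|d 0 i|.
have he i : 0 <= e 0 i by rewrite mxE.
pose P := adjmx U *m diag_mx e *m U.
have hP : psd P by apply: psd_diag_conj.
have hXX : adjmx X = X.
  rewrite eX !adjmxM adjmxK mulmxA; congr (_ *m _ *m _).
  apply/matrixP=> i j; rewrite adjmxE !mxE eq_sym.
  by case: eqP => [->|_]; rewrite ?mulr0n ?conjC0 // !mulr1n; apply/CrealP.
have sq (f : 'rV[C]_n) : (adjmx U *m diag_mx f *m U) *m (adjmx U *m diag_mx f *m U)
   = adjmx U *m diag_mx (\row_i (f 0 i ^+ 2)) *m U.
  transitivity (adjmx U *m (diag_mx f *m (U *m adjmx U) *m diag_mx f) *m U).
    by rewrite !mulmxA.
  rewrite hU mulmx1 mulmx_diag.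
  suff -> : \row_i f 0 i ^+ 2 = \row_i (f 0 i * f 0 i) by [].
  by apply/rowP=> i; rewrite !mxE expr2.
have hPP : P *m P = adjmx X *m X.
  rewrite hXX eX /P !sq; congr (_ *m diag_mx _ *m _).
  by apply/rowP=> i; rewrite !mxE real_normK.
rewrite /trnorm.
have -> : xget 0 [set Q : 'M[C]_n | psd Q /\ Q *m Q = adjmx X *m X] = P.
  have := @xgetI _ 0 [set Q : 'M[C]_n | psd Q /\ Q *m Q = adjmx X *m X] P.
  case=> // hQ hQQ; apply: psd_sqr_inj => //.
  by rewrite hQQ hPP.
rewrite /P mxtrace_diag_conj // RRe_real.
  by apply: eq_bigr => i _; rewrite mxE.
by apply: ger0_real; apply: sumr_ge0.
Qed.

(** In an eigenbasis of [A - B], each eigenvalue is a difference of nonnegative diagonal entries of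
    [A] and [B], and its modulus is at most their sum. *)
Lemma trnorm_sub_psd n (A B : 'M[C]_n) : psd A -> psd B ->
  ((trnorm (A - B))%:C)%C <= \tr A + \tr B.
Proof.
move=> hA hB.
have hX : adjmx (A - B) = A - B by rewrite adjmxB !psd_herm.
have [U [d [h1 h2 hd eX]]] := herm_spectral hX.
rewrite (trnorm_spectral h1 hd eX).
pose W (Y : 'M[C]_n) := U *m Y *m adjmx U.
have trW Y : \tr (W Y) = \tr Y by rewrite /W mxtrace_mulC mulmxA h2 mul1mx.
have hW Y : psd Y -> psd (W Y).
  by move=> hY; rewrite /W -{1}[U]adjmxK; apply: psd_conj.
rewrite -(trW A) -(trW B) /mxtrace -big_split /=; apply: ler_sum => i _.
have -> : d 0 i = W A i i - W B i i.
  transitivity (W (A - B) i i); last by rewrite /W mulmxBr mulmxBl mxEB.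
  by rewrite /W eX !mulmxA h1 mul1mx -mulmxA h1 mulmx1 mxE eqxx.
apply: le_trans (ler_normB _ _) _.
by rewrite !ger0_norm //; apply/psd_diag_ge0/hW.
Qed.

(** Jordan decomposition: [P] and [Q] carry the positive and negative parts of the spectrum. This
    split attains the bound of [trnorm_sub_psd]. *)
Lemma herm_jordan n (X : 'M[C]_n) : adjmx X = X ->
  exists P Q : 'M[C]_n, [/\ psd P, psd Q, X = P - Q
    & ((trnorm X)%:C)%C = \tr P + \tr Q].
Proof.
move=> hX; have [U [d [h1 h2 hd eX]]] := herm_spectral hX.
pose p : 'rV[C]_n := \row_i ((`|d 0 i| + d 0 i) / 2).
pose q : 'rV[C]_n := \row_i ((`|d 0 i| - d 0 i) / 2).
exists (adjmx U *m diag_mx p *m U), (adjmx U *m diag_mx q *m U); split.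
- by apply: psd_diag_conj => i; rewrite mxE divr_ge0 // -[X in _ + X]opprK
    subr_ge0 -normrN real_ler_norm // rpredN.
- by apply: psd_diag_conj => i; rewrite mxE divr_ge0 // subr_ge0 real_ler_norm.
- rewrite eX -mulmxBl -mulmxBr -raddfB /=.
  congr (_ *m (diag_mx _) *m _); apply/rowP=> i; rewrite !mxE.
  rewrite -mulrBl opprB addrCA (addrC `|d 0 i|) addrK -mulr2n.
  by rewrite -(mulr_natr (d 0 i)) mulfK // pnatr_eq0.
rewrite (trnorm_spectral h1 hd eX) !mxtrace_diag_conj // -big_split /=.
apply: eq_bigr => i _; rewrite !mxE -mulrDl addrCA addrK -mulr2n.
by rewrite -(mulr_natr `|d 0 i|) mulfK // pnatr_eq0.
Qed.

(** Positive trace-preserving linear maps: the class on which contraction of the trace norm is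
    proved. A whole strategy, viewed as a function of the resource, will be such a map. *)
Definition ptp m n (F : mapT R m n) :=
  [/\ linmap F, forall X, psd X -> psd (F X) & tp F].

Lemma linmapB m n (F : mapT R m n) X Y : linmap F -> F (X - Y) = F X - F Y.
Proof.
move=> hF; have -> : X - Y = (-1) *: Y + X by rewrite scaleN1r addrC.
by rewrite hF scaleN1r addrC.
Qed.

(** The images of the Jordan parts of [X] are positive with unchanged traces, so [trnorm_sub_psd]
    bounds the norm of their difference. *)
Lemma trnorm_contract m n (F : mapT R m n) X : ptp F -> adjmx X = X ->
  trnorm (F X) <= trnorm X.
Proof.
case=> lF pF tF hX; have [P [Q [hP hQ -> e]]] := herm_jordan hX.
rewrite linmapB // -lecR; apply: le_trans (trnorm_sub_psd _ _) _; auto.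
by rewrite !tF -e; have [P' [Q' []]] := herm_jordan hX.
Qed.

End Spectral.

(** * Index arithmetic of tensor products *)

Lemma fst_ix m n (i : 'I_m) (j : 'I_n) : fstI (ix i j) = i.
Proof. by rewrite /fstI /ix mxtens_indexK. Qed.

Lemma snd_ix m n (i : 'I_m) (j : 'I_n) : sndI (ix i j) = j.
Proof. by rewrite /sndI /ix mxtens_indexK. Qed.

Lemma ix_eta m n (k : 'I_(m * n)) : ix (fstI k) (sndI k) = k.
Proof. by rewrite /ix /fstI /sndI -surjective_pairing mxtens_unindexK. Qed.

Definition ixE := (fst_ix, snd_ix, ix_eta).

(** * Maps acting on a tensor factor *)

Section Calculus.

Variable R : realType.
Local Notation C := (R[i]).
Local Notation idt k F := (@idten R k _ _ F).

Lemma sum_ix m n (G : 'I_(m * n) -> C) : \sum_k G k = \sum_i \sum_j G (ix i j).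
Proof.
rewrite pair_bigA (reindex (fun p : 'I_m * 'I_n => ix p.1 p.2)) //=.
exists (fun k => (fstI k, sndI k)) => [[i j] _|k _] /=; last exact: ix_eta.
by rewrite fst_ix snd_ix.
Qed.

Lemma sum2_ix m n (G : 'I_(m * n) -> 'I_(m * n) -> C) :
  \sum_k \sum_k' G k k' =
  \sum_i \sum_i' \sum_j \sum_j' G (ix i j) (ix i' j').
Proof.
rewrite sum_ix; apply: eq_bigr => i _; rewrite [RHS]exchange_big /=.
by apply: eq_bigr => j _; rewrite sum_ix.
Qed.

Lemma sum_pair (I J : finType) (G : I * J -> C) : \sum_p G p = \sum_i \sum_j G (i, j).
Proof. by rewrite pair_bigA; apply: eq_bigr => -[]. Qed.

Lemma sum_delta m n (G : 'I_m * 'I_n -> C) a b :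
  \sum_p G p * delta_mx p.1 p.2 a b = G (a, b).
Proof.
rewrite (bigD1 (a, b)) //= mxE !eqxx mulr1 big1 ?addr0 // => -[x y] /= h.
rewrite mxE; case: eqP => [e1|_]; last by rewrite mulr0.
by case: eqP => [e2|_]; rewrite ?mulr0 //; move: h; rewrite e1 e2 eqxx.
Qed.

Lemma linmap0 m n (F : mapT R m n) : linmap F -> F 0 = 0.
Proof. by move=> hF; have := linmapB 0 0 hF; rewrite !subrr. Qed.

Lemma linmapD m n (F : mapT R m n) X Y : linmap F -> F (X + Y) = F X + F Y.
Proof. by move=> hF; have := hF 1 X Y; rewrite !scale1r. Qed.

Lemma linmapZ m n (F : mapT R m n) c X : linmap F -> F (c *: X) = c *: F X.
Proof. by move=> hF; rewrite -[_ *: X]addr0 hF linmap0 // addr0. Qed.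

Lemma linmap_sum m n (F : mapT R m n) I (r : seq I) (P : pred I) (X : I -> 'M[C]_m) :
  linmap F -> F (\sum_(i <- r | P i) X i) = \sum_(i <- r | P i) F (X i).
Proof.
move=> hF; apply: (big_morph F) => [X1 X2|]; [exact: linmapD|exact: linmap0].
Qed.

Lemma linmap_delta m n (F : mapT R m n) X i j : linmap F ->
  F X i j = \sum_p X p.1 p.2 * F (delta_mx p.1 p.2) i j.
Proof.
move=> hF; rewrite {1}(matrix_sum_delta X) pair_bigA linmap_sum // summxE.
by apply: eq_bigr => p _; rewrite linmapZ // mxE.
Qed.

Lemma linmap_comp m n p (F : mapT R n p) (G : mapT R m n) :
  linmap F -> linmap G -> linmap (fun X => F (G X)).
Proof. by move=> hF hG c X Y; rewrite hG hF. Qed.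

(** For bijective [f] this permutes tensor factors; for [fun i => ix i u] it compresses by a basis
    vector, so that partial traces are sums of such maps. *)
Definition reix p q (f : 'I_p -> 'I_q) (X : 'M[C]_q) : 'M[C]_p :=
  \matrix_(i, j) X (f i) (f j).

(* F acts on the factor x of the input index u i x, all other factors being
   carried over; v i is the output index of F. *)
Definition liftmap p q x x' (u : 'I_p -> 'I_x -> 'I_q) (v : 'I_p -> 'I_x')
    (F : mapT R x x') (X : 'M[C]_q) : 'M[C]_p :=
  \matrix_(i, j) \sum_s X (u i s.1) (u j s.2) * F (delta_mx s.1 s.2) (v i) (v j).

(** A tensor product whose factors sit at prescribed places of the index: the common form of [bten]
    and [attach]. *)
Definition tensat p q r (f : 'I_p -> 'I_q) (g : 'I_p -> 'I_r)
    (X : 'M[C]_q) (Y : 'M[C]_r) : 'M[C]_p :=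
  \matrix_(i, j) (X (f i) (f j) * Y (g i) (g j)).

(** This and the next lemmas bring every way of applying a channel to [liftmap] form, so that
    identities between circuits reduce to identities between index functions, settled by [ixE]. *)
Lemma idtenE k m n (F : mapT R m n) :
  idt k F = liftmap (fun i s => ix (fstI i) s) (@sndI k n) F.
Proof.
by apply/funext=> X; apply/matrixP=> i j; rewrite !mxE pair_bigA.
Qed.

Lemma mapten_idr x x' y (E : mapT R x x') :
  mapten E id = liftmap (fun i s => ix s (@sndI x' y i)) (@fstI x' y) E.
Proof.
apply/funext=> X; apply/matrixP=> i j; rewrite !mxE pair_bigA /=.
apply: eq_bigr => -[a a'] _ /=; rewrite pair_bigA /=.
by rewrite (sum_delta (fun p => X (ix a p.1) (ix a' p.2) * _)).
Qed.

Lemma mapten_idl x y y' (F : mapT R y y') :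
  mapten id F = liftmap (fun i s => ix (@fstI x y' i) s) (@sndI x y') F.
Proof.
apply/funext=> X; apply/matrixP=> i j; rewrite !mxE pair_bigA /=.
under eq_bigr => p _ do (rewrite pair_bigA /=;
  under eq_bigr => p' _ do rewrite mulrAC; rewrite -mulr_suml).
by rewrite (sum_delta (fun p => \sum_p' X (ix p.1 p'.1) (ix p.2 p'.2) * _)).
Qed.

Lemma apply_midE am bm a' b' a b (N : mapT R (a' * b') (a * b)) :
  @apply_mid R am bm a' b' a b N =
  liftmap (fun i s => ix (ix (fstI (fstI i)) (fstI s)) (ix (sndI s) (sndI (sndI i))))
       (fun i => ix (sndI (fstI i)) (fstI (sndI i))) N.
Proof.
apply/funext=> X; apply/matrixP=> i j; rewrite !mxE.
rewrite sum_pair sum2_ix.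
do 4![apply: eq_bigr => ? _]; by rewrite !ixE.
Qed.

Lemma apply_memE r r' a b a' b' m1 m2 (F : mapT R (r * (a * b)) (r' * (a' * b'))) :
  @apply_mem R r r' a b a' b' m1 m2 F =
  liftmap (fun i s => ix (fstI s) (ix (ix (fstI (sndI s)) (sndI (fstI (sndI i))))
                                   (ix (sndI (sndI s)) (sndI (sndI (sndI i))))))
       (fun i => ix (fstI i) (ix (fstI (fstI (sndI i))) (fstI (sndI (sndI i))))) F.
Proof.
apply/funext=> X; apply/matrixP=> i j; rewrite !mxE.
rewrite sum_pair sum2_ix.
apply: eq_bigr => x _; apply: eq_bigr => x' _; rewrite sum2_ix.
do 4![apply: eq_bigr => ? _]; by rewrite !ixE.
Qed.

Lemma eq_liftmap p q x x' (u u' : 'I_p -> 'I_x -> 'I_q) (v v' : 'I_p -> 'I_x')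
    (F : mapT R x x') :
  (forall i s, u i s = u' i s) -> v =1 v' -> liftmap u v F = liftmap u' v' F.
Proof.
move=> hu hv; have -> : u = u' by apply/funext=> i; apply/funext=> s.
by have -> : v = v' by apply/funext.
Qed.

Lemma eq_reix p q (f g : 'I_p -> 'I_q) : f =1 g -> reix f = reix g.
Proof. by move=> /funext->. Qed.

Lemma reix_id p (f : 'I_p -> 'I_p) X : f =1 id -> reix f X = X.
Proof. by move=> h; apply/matrixP=> i j; rewrite mxE !h. Qed.

Lemma reix_comp p q r (f : 'I_p -> 'I_q) (g : 'I_q -> 'I_r) X :
  reix f (reix g X) = reix (g \o f) X.
Proof. by apply/matrixP=> i j; rewrite !mxE. Qed.

Lemma linmap_reix p q (f : 'I_p -> 'I_q) : linmap (reix f).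
Proof. by move=> c X Y; apply/matrixP=> i j; rewrite !mxE. Qed.

Lemma linmap_liftmap p q x x' u v F : linmap (@liftmap p q x x' u v F).
Proof.
move=> c X Y; apply/matrixP=> i j; rewrite !mxE mulr_sumr -big_split /=.
by apply: eq_bigr => s _; rewrite !mxE mulrDl mulrA.
Qed.

Lemma reix_liftmap p q r x x' (u : 'I_p -> 'I_x -> 'I_q) (v : 'I_p -> 'I_x')
    (f : 'I_r -> 'I_p) (F : mapT R x x') X :
  reix f (liftmap u v F X) = liftmap (fun i => u (f i)) (fun i => v (f i)) F X.
Proof. by apply/matrixP=> i j; rewrite !mxE. Qed.

Lemma liftmap_reix p q r x x' (u : 'I_p -> 'I_x -> 'I_q) (v : 'I_p -> 'I_x')
    (f : 'I_q -> 'I_r) (F : mapT R x x') X :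
  liftmap u v F (reix f X) = liftmap (fun i s => f (u i s)) v F X.
Proof. by apply/matrixP=> i j; rewrite !mxE; under eq_bigr do rewrite !mxE. Qed.

Lemma liftmap_map_reix p q x x' (u : 'I_p -> 'I_x -> 'I_q) (v : 'I_p -> 'I_x')
    (f : 'I_x' -> 'I_x) : liftmap u v (reix f) = reix (fun i => u i (f (v i))).
Proof.
apply/funext=> X; apply/matrixP=> i j; rewrite !mxE.
under eq_bigr do rewrite mxE.
by rewrite (sum_delta (fun s => X (u i s.1) (u j s.2))).
Qed.

Lemma liftmap_liftmap p q x x' y y' (u : 'I_p -> 'I_x -> 'I_q) (v : 'I_p -> 'I_x')
    (u' : 'I_x' -> 'I_y -> 'I_x) (v' : 'I_x' -> 'I_y') (F : mapT R y y') :
  liftmap u v (liftmap u' v' F) = liftmap (fun i s => u i (u' (v i) s)) (fun i => v' (v i)) F.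
Proof.
apply/funext=> X; apply/matrixP=> i j; rewrite !mxE.
under eq_bigr => s _ do rewrite mxE mulr_sumr.
rewrite exchange_big /=; apply: eq_bigr => t _.
under eq_bigr do rewrite mulrA; rewrite -mulr_suml.
by rewrite (sum_delta (fun s => X (u i s.1) (u j s.2))).
Qed.

(** The hypotheses on indices say that [F] reads exactly the factor written by [G], and that the
    spectators seen by [G] do not depend on the value written there. *)
Lemma liftmap_comp p q r x y z (u : 'I_p -> 'I_y -> 'I_q) (v : 'I_p -> 'I_z)
    (u' : 'I_q -> 'I_x -> 'I_r) (v' : 'I_q -> 'I_y) (w : 'I_p -> 'I_x -> 'I_r)
    (F : mapT R y z) (G : mapT R x y) X :
  linmap F -> (forall i s, v' (u i s) = s) -> (forall i s t, u' (u i s) t = w i t) ->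
  liftmap u v F (liftmap u' v' G X) = liftmap w v (fun Y => F (G Y)) X.
Proof.
move=> hF hv hu; apply/matrixP=> i j; rewrite !mxE.
under eq_bigr => s _ do (rewrite mxE mulr_suml; under eq_bigr => t _ do rewrite !hv !hu).
rewrite exchange_big /=; apply: eq_bigr => t _.
rewrite (linmap_delta (G _)) // mulr_sumr; apply: eq_bigr => s _.
by rewrite mulrA.
Qed.

Lemma liftmap_sandwich p q x x' y y' (u : 'I_p -> 'I_x -> 'I_q) (v : 'I_p -> 'I_x')
    (f : 'I_x' -> 'I_y') (g : 'I_y -> 'I_x) (G : mapT R y y') :
  linmap G ->
  liftmap u v (fun X => reix f (G (reix g X))) = liftmap (fun i s => u i (g s)) (fun i => f (v i)) G.
Proof.
move=> hG; apply/funext=> X; apply/matrixP=> i j; rewrite !mxE.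
under eq_bigr => s _.
  rewrite mxE (linmap_delta (reix _ _)) // mulr_sumr.
  under eq_bigr do rewrite mxE mulrA.
  over.
rewrite exchange_big /=; apply: eq_bigr => t _; rewrite -mulr_suml.
by rewrite (sum_delta (fun s => X (u i s.1) (u j s.2))).
Qed.

Lemma liftmap_sum p q x x' (u : 'I_p -> 'I_x -> 'I_q) (v : 'I_p -> 'I_x')
    I (r : seq I) (P : pred I) (F : I -> mapT R x x') X :
  liftmap u v (fun Y => \sum_(i <- r | P i) F i Y) X = \sum_(i <- r | P i) liftmap u v (F i) X.
Proof.
apply/matrixP=> i j; rewrite summxE !mxE.
under eq_bigr do rewrite summxE mulr_sumr.
by rewrite exchange_big /=; apply: eq_bigr => k _; rewrite mxE.
Qed.

(** * Complete positivity and trace preservation of lifted maps *)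

Lemma psd_reix p q (f : 'I_p -> 'I_q) (X : 'M[C]_q) : psd X -> psd (reix f X).
Proof.
(* Reindexing is the congruence by the 0-1 matrix of [f], whether or not [f] is injective. *)
move=> hX; pose B : 'M[C]_(q, p) := \matrix_(a, i) (a == f i)%:R.
suff -> : reix f X = adjmx B *m X *m B by apply: psd_conj.
apply/matrixP=> i j; rewrite !mxE (bigD1 (f j)) //= !mxE eqxx mulr1.
rewrite [X in _ + X]big1 ?addr0; last by move=> a /negbTE h; rewrite [B _ _]mxE h mulr0.
rewrite (bigD1 (f i)) //= adjmxE mxE eqxx rmorph1 mul1r.
by rewrite big1 ?addr0 // => a /negbTE h; rewrite adjmxE mxE h rmorph0 mul0r.
Qed.

(** The whole output index serves as the reference system, so positivity of a lift follows from
    complete positivity of [F] for arbitrary [u] and [v]. *)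
Lemma liftmap_idten p q x x' (u : 'I_p -> 'I_x -> 'I_q) (v : 'I_p -> 'I_x') F X :
  liftmap u v F X =
  reix (fun i => ix i (v i)) (idt p F (reix (fun k => u (fstI k) (sndI k)) X)).
Proof.
rewrite idtenE liftmap_reix reix_liftmap; congr (_ X).
by apply: eq_liftmap => [i s|i]; rewrite !ixE.
Qed.

Lemma psd_liftmap p q x x' (u : 'I_p -> 'I_x -> 'I_q) (v : 'I_p -> 'I_x') F X :
  cp F -> psd X -> psd (liftmap u v F X).
Proof.
by move=> [_ hF] hX; rewrite liftmap_idten; apply/psd_reix/hF/psd_reix.
Qed.

Lemma cp_liftmap p q x x' (u : 'I_p -> 'I_x -> 'I_q) (v : 'I_p -> 'I_x') F :
  cp F -> cp (liftmap u v F).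
Proof.
move=> hF; split; first exact: linmap_liftmap.
by move=> k X hX; rewrite idtenE liftmap_liftmap; apply: psd_liftmap.
Qed.

Lemma cp_reix p q (f : 'I_p -> 'I_q) : cp (reix f).
Proof.
split; first exact: linmap_reix.
by move=> k X hX; rewrite idtenE liftmap_map_reix; apply: psd_reix.
Qed.

Lemma liftmap1 x x' (F : mapT R x x') X : linmap F ->
  F X = liftmap (fun (i : 'I_x') s => s) id F X.
Proof. by move=> hF; apply/matrixP=> i j; rewrite mxE linmap_delta. Qed.

Lemma cp_psd x x' (F : mapT R x x') X : cp F -> psd X -> psd (F X).
Proof. by move=> hF hX; rewrite liftmap1; [apply: psd_liftmap|case: hF]. Qed.

Lemma cp_comp x y z (F : mapT R y z) (G : mapT R x y) :
  cp F -> cp G -> cp (fun X => F (G X)).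
Proof.
move=> hF hG; split; first by apply: linmap_comp; [case: hF|case: hG].
move=> k X hX.
have <- : idt k F (idt k G X) = idt k (fun X => F (G X)) X.
  rewrite !idtenE; apply: liftmap_comp => [|i s|i s t]; rewrite ?ixE //; by case: hF.
by case: hF => _; apply; case: hG => _; apply.
Qed.

Lemma cp_sum x y I (r : seq I) (P : pred I) (F : I -> mapT R x y) :
  (forall i, P i -> cp (F i)) -> cp (fun X => \sum_(i <- r | P i) F i X).
Proof.
move=> hF; split=> [c X Y|k X hX].
  rewrite scaler_sumr -big_split; apply: eq_bigr => i /hF[h _]; exact: h.
by rewrite idtenE liftmap_sum; apply: psd_sum => i /hF h; apply: psd_liftmap.
Qed.

Lemma tp_comp x y z (F : mapT R y z) (G : mapT R x y) :
  tp F -> tp G -> tp (fun X => F (G X)).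
Proof. by move=> hF hG X; rewrite hF. Qed.

Lemma cptp_comp x y z (F : mapT R y z) (G : mapT R x y) :
  cptp F -> cptp G -> cptp (fun X => F (G X)).
Proof.
by move=> [? ?] [? ?]; split; [apply: cp_comp|apply: tp_comp].
Qed.

Lemma tp_reix p q (f : 'I_p -> 'I_q) : bijective f -> tp (reix f).
Proof.
move=> [g fK gK] X; rewrite /mxtrace; under eq_bigr do rewrite mxE.
by rewrite [RHS](reindex f) //; exists g => i _.
Qed.

Lemma cptp_reix p q (f : 'I_p -> 'I_q) : bijective f -> cptp (reix f).
Proof. by split; [apply: cp_reix|apply: tp_reix]. Qed.

Lemma tp_idten k x y (F : mapT R x y) : tp F -> tp (idt k F).
Proof.
move=> hF X; rewrite /mxtrace !sum_ix; apply: eq_bigr => c _.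
under eq_bigr => b _ do rewrite mxE pair_bigA /= !ixE.
rewrite exchange_big /=.
(* Summing over the output of [F] leaves the trace of [F] at a matrix unit, which is a Kronecker
   symbol. *)
under eq_bigr => s _.
  rewrite -mulr_sumr -[\sum_j _]/(\tr (F _)) hF.
  have -> : \tr (delta_mx s.1 s.2 : 'M[C]_x) = (s.1 == s.2)%:R.
    rewrite /mxtrace (bigD1 s.1) //= mxE eqxx big1 ?addr0 // => i /negbTE h.
    by rewrite mxE h.
  over.
rewrite sum_pair /=.
apply: eq_bigr => s _; rewrite (bigD1 s) //= eqxx mulr1 big1 ?addr0 // => t.
by rewrite eq_sym => /negbTE->; rewrite mulr0.
Qed.

(* liftmap u v F is F on one tensor factor, up to bijective renamings f and g of
   the output and input indices; this is what makes it trace preserving. *)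
Definition regroup p q x x' (u : 'I_p -> 'I_x -> 'I_q) (v : 'I_p -> 'I_x') :=
  exists m (f : 'I_p -> 'I_(m * x')) (g : 'I_(m * x) -> 'I_q),
    [/\ bijective f, bijective g, forall i, sndI (f i) = v i
      & forall i s, u i s = g (ix (fstI (f i)) s)].

Lemma tp_liftmap p q x x' (u : 'I_p -> 'I_x -> 'I_q) (v : 'I_p -> 'I_x') F :
  regroup u v -> tp F -> tp (liftmap u v F).
Proof.
move=> [m [f [g [hf hg hv hu]]]] hF X.
have -> : liftmap u v F X = reix f (idt m F (reix g X)).
  by rewrite idtenE liftmap_reix reix_liftmap; congr (_ X); apply: eq_liftmap => [i s|i].
by rewrite tp_reix // tp_idten // tp_reix.
Qed.

Lemma cptp_liftmap p q x x' (u : 'I_p -> 'I_x -> 'I_q) (v : 'I_p -> 'I_x') F :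
  regroup u v -> cptp F -> cptp (liftmap u v F).
Proof. by move=> h [? ?]; split; [apply: cp_liftmap|apply: tp_liftmap]. Qed.

Lemma bij_id p : bijective (@id 'I_p). Proof. by exists id. Qed.

Lemma regroup_std k x x' : regroup (fun i s => ix (@fstI k x' i) s : 'I_(k * x)) sndI.
Proof. by exists k, id, id; split=> //; apply: bij_id. Qed.

Definition ixswap m n (i : 'I_(m * n)) : 'I_(n * m) := ix (sndI i) (fstI i).

Lemma bij_ixswap m n : bijective (@ixswap m n).
Proof. by exists (@ixswap n m) => i; rewrite /ixswap !ixE. Qed.

Lemma regroup_alice k x x' : regroup (fun i s => ix s (@sndI x' k i) : 'I_(x * k)) fstI.
Proof.
exists k, (@ixswap _ _), (@ixswap _ _).
by split=> [||i|i s]; rewrite /ixswap ?ixE //; apply: bij_ixswap.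
Qed.

End Calculus.

(** * LOCC channels *)

Section Locc.

Variable R : realType.
Local Notation C := (R[i]).
Local Notation idt k F := (@idten R k _ _ F).

Lemma psd_tens m n (A : 'M[C]_m) (B : 'M[C]_n) : psd A -> psd B -> psd (A *t B).
Proof.
move=> /psd_factor[D ->] /psd_factor[E ->]; rewrite -tensmx_mul.
suff -> : adjmx D *t adjmx E = adjmx (D *t E) by apply: psd_gram.
by apply/matrixP=> i j; rewrite !(adjmxE, mxE) rmorphM.
Qed.

Lemma tensat_tens p q r (f : 'I_p -> 'I_q) (g : 'I_p -> 'I_r) (X : 'M[C]_q) (Y : 'M[C]_r) :
  tensat f g X Y = reix (fun i => ix (f i) (g i)) (X *t Y).
Proof. by apply/matrixP=> i j; rewrite !mxE -!/(fstI _) -!/(sndI _) !ixE. Qed.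

Lemma psd_tensat p q r (f : 'I_p -> 'I_q) (g : 'I_p -> 'I_r) (X : 'M[C]_q) (Y : 'M[C]_r) :
  psd X -> psd Y -> psd (tensat f g X Y).
Proof. by move=> hX hY; rewrite tensat_tens; apply/psd_reix/psd_tens. Qed.

Lemma btenE a1 b1 a2 b2 (X : 'M[C]_(a1 * b1)) (Y : 'M[C]_(a2 * b2)) :
  bten X Y = tensat (fun i => ix (fstI (fstI i)) (fstI (sndI i)))
                   (fun i => ix (sndI (fstI i)) (sndI (sndI i))) X Y.
Proof. by []. Qed.

Lemma linmap_tensat p q r (f : 'I_p -> 'I_q) (g : 'I_p -> 'I_r) (Y : 'M[C]_r) :
  linmap (fun X => tensat f g X Y).
Proof. by move=> c X Z; apply/matrixP=> i j; rewrite !mxE mulrDl mulrA. Qed.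

Lemma liftmap_map_tensat p q x x' r (u : 'I_p -> 'I_x -> 'I_q) (v : 'I_p -> 'I_x')
    (f : 'I_x' -> 'I_x) (g : 'I_x' -> 'I_r) (Y : 'M[C]_r) X :
  liftmap u v (fun X => tensat f g X Y) X =
  tensat (fun i => u i (f (v i))) (fun i => g (v i)) X Y.
Proof.
apply/matrixP=> i j; rewrite !mxE.
under eq_bigr do rewrite mxE mulrA; rewrite -mulr_suml; congr (_ * _).
by rewrite (sum_delta (fun s => X (u i s.1) (u j s.2))).
Qed.

Lemma cp_tensat p q r (f : 'I_p -> 'I_q) (g : 'I_p -> 'I_r) (Y : 'M[C]_r) :
  psd Y -> cp (fun X => tensat f g X Y).
Proof.
move=> hY; split; first exact: linmap_tensat.
by move=> k X hX; rewrite idtenE liftmap_map_tensat; apply: psd_tensat.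
Qed.

Lemma mxtrace_tens m n (X : 'M[C]_m) (Y : 'M[C]_n) : \tr (X *t Y) = \tr X * \tr Y.
Proof.
rewrite /mxtrace sum_ix mulr_suml; apply: eq_bigr => i _.
rewrite mulr_sumr; apply: eq_bigr => j _.
by rewrite !mxE -!/(fstI _) -!/(sndI _) !ixE.
Qed.

Lemma mxtrace_tensat p q r (f : 'I_p -> 'I_q) (g : 'I_p -> 'I_r) (X : 'M[C]_q) (Y : 'M[C]_r) :
  bijective (fun i => ix (f i) (g i)) -> \tr (tensat f g X Y) = \tr X * \tr Y.
Proof. by move=> h; rewrite tensat_tens tp_reix // mxtrace_tens. Qed.

(** Induction on the protocol. In a composition, the instrument [Nf j] preserves the trace of the
    branch [M j X]; coarse-graining only regroups the sum over outcomes. *)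
Lemma locc_instr_instrument x y x' y' k (M : 'I_k -> mapT R (x * y) (x' * y')) :
  locc_instr M -> instrument M.
Proof.
elim=> {x y x' y' k M}.
- move=> x y x' k E [cE tE]; split=> [j|X].
    by rewrite mapten_idr; apply: cp_liftmap.
  under eq_bigr do rewrite mapten_idr; rewrite -liftmap_sum.
  exact: (tp_liftmap (regroup_alice _ _ _)).
- move=> x y y' k F [cF tF]; split=> [j|X].
    by rewrite mapten_idl; apply: cp_liftmap.
  under eq_bigr do rewrite mapten_idl; rewrite -liftmap_sum.
  exact: (tp_liftmap (regroup_std _ _ _)).
- move=> x y x1 y1 x2 y2 k k' M Nf _ [cM tM] _ hN; split=> [l|X].
    by apply: cp_comp => //; case: (hN (fstI l)).
  rewrite raddf_sum /= sum_ix -[RHS]tM raddf_sum /=; apply: eq_bigr => j _.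
  under eq_bigr do rewrite !ixE.
  by case: (hN j) => _ /(_ (M j X)) <-; rewrite raddf_sum.
move=> x y x' y' k k' M f _ [cM tM]; split=> [j|X].
  by apply: cp_sum => i _; apply: cM.
rewrite -[RHS]tM; congr (\tr _); rewrite [RHS](partition_big f xpredT) //=.
Qed.

Lemma locc_cptp x y x' y' (L : mapT R (x * y) (x' * y')) : locc L -> cptp L.
Proof.
move=> [k [M [/locc_instr_instrument[cM tM] /funext->]]].
by split; [apply: cp_sum|].
Qed.

Lemma locc_comp x y x1 y1 x2 y2 (L : mapT R (x1 * y1) (x2 * y2))
    (K : mapT R (x * y) (x1 * y1)) :
  locc L -> locc K -> locc (fun X => L (K X)).
Proof.
move=> hL [k [M [hM eM]]]; have [[lL _] _] := locc_cptp hL.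
case: hL => k' [N [hN eN]].
exists (k * k')%N, (fun l X => N (sndI l) (M (fstI l) X)); split.
  (* The second protocol is run whatever the outcome of the first. *)
  exact: (li_comp hM (fun=> hN)).
move=> X; rewrite eM linmap_sum //; apply/matrixP=> i j; rewrite !summxE sum_ix.
apply: eq_bigr => a _; rewrite eN summxE.
by apply: eq_bigr => b _; rewrite !ixE.
Qed.

Lemma locc_alice x y x' (E : mapT R x x') : cptp E -> locc (@mapten R x x' y y E id).
Proof.
move=> [cE tE]; exists 1%N, (fun=> mapten E id); split.
  apply: (@li_alice R x y x' 1 (fun=> E)); split=> // X.
  by rewrite big_ord1 tE.
by move=> X; rewrite big_ord1.
Qed.

Lemma locc_bob x y y' (F : mapT R y y') : cptp F -> locc (@mapten R x x y y' id F).
Proof.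
move=> [cF tF]; exists 1%N, (fun=> mapten id F); split.
  apply: (@li_bob R x y y' 1 (fun=> F)); split=> // X.
  by rewrite big_ord1 tF.
by move=> X; rewrite big_ord1.
Qed.

(** Index functions that respect the cut: one component for Alice, one for Bob. Lifts along such
    pairs are the ones that can stay LOCC. *)
Definition pairin p q x p' q' x' (u : 'I_p -> 'I_x -> 'I_q) (u' : 'I_p' -> 'I_x' -> 'I_q')
  (i : 'I_(p * p')) (s : 'I_(x * x')) := ix (u (fstI i) (fstI s)) (u' (sndI i) (sndI s)).

Definition pairout p x p' x' (v : 'I_p -> 'I_x) (v' : 'I_p' -> 'I_x') (i : 'I_(p * p')) :=
  ix (v (fstI i)) (v' (sndI i)).

Lemma locc_reix p q p' q' (f : 'I_p -> 'I_q) (g : 'I_p' -> 'I_q') :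
  bijective f -> bijective g -> locc (@reix R _ _ (pairout f g)).
Proof.
move=> hf hg.
have -> : reix (pairout f g) = fun X => mapten id (reix g) (@mapten R q p q' q' (reix f) id X).
  apply/funext=> X; rewrite mapten_idl mapten_idr !liftmap_map_reix reix_comp.
  by congr (_ X); apply: eq_reix => i; rewrite /= /pairout !ixE.
by apply: locc_comp; [apply/locc_bob/cptp_reix|apply/locc_alice/cptp_reix].
Qed.

Definition ext_std m1 m2 x y x' y' (L : mapT R (x * y) (x' * y')) :
    mapT R ((m1 * x) * (m2 * y)) ((m1 * x') * (m2 * y')) :=
  liftmap (pairin (fun i s => ix (fstI i) s) (fun i s => ix (fstI i) s)) (pairout sndI sndI) L.

Arguments ext_std m1 m2 {x y x' y'} L X.

Lemma instrument_idten m x y k (E : 'I_k -> mapT R x y) :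
  instrument E -> instrument (fun j => idt m (E j)).
Proof.
move=> [cE tE]; split=> [j|X]; first by rewrite idtenE; apply: cp_liftmap.
under eq_bigr do rewrite idtenE; rewrite -liftmap_sum -idtenE.
exact: (tp_idten tE).
Qed.

(** Induction on the protocol: a local instrument beside an idle system of the same party is again a
    local instrument, and extension commutes with composition and coarse-graining. *)
Lemma locc_instr_ext m1 m2 x y x' y' k (M : 'I_k -> mapT R (x * y) (x' * y')) :
  locc_instr M -> locc_instr (fun j => ext_std m1 m2 (M j)).
Proof.
elim=> {x y x' y' k M}.
- move=> x y x' k E hE.
  have -> : (fun j => ext_std m1 m2 (mapten (E j) id)) =
            (fun j => @mapten R _ _ (m2 * y) _ (idt m1 (E j)) id).
    apply/funext=> j; rewrite /ext_std !mapten_idr idtenE !liftmap_liftmap.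
    by apply: eq_liftmap => [i s|i]; rewrite /pairin /pairout !ixE.
  by apply: li_alice; apply: instrument_idten.
- move=> x y y' k F hF.
  have -> : (fun j => ext_std m1 m2 (mapten id (F j))) =
            (fun j => @mapten R (m1 * x) _ _ _ id (idt m2 (F j))).
    apply/funext=> j; rewrite /ext_std !mapten_idl idtenE !liftmap_liftmap.
    by apply: eq_liftmap => [i s|i]; rewrite /pairin /pairout !ixE.
  by apply: li_bob; apply: instrument_idten.
- move=> x y x1 y1 x2 y2 k k' M Nf _ hM hN0 hN.
  have -> : (fun l : 'I_(k * k') => ext_std m1 m2
               (fun X => Nf (fstI l) (sndI l) (M (fstI l) X))) =
      (fun l X => ext_std m1 m2 (Nf (fstI l) (sndI l)) (ext_std m1 m2 (M (fstI l)) X)).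
    apply/funext=> l; apply/funext=> X; rewrite /ext_std; apply/esym/liftmap_comp.
    + by case: (locc_instr_instrument (hN0 (fstI l))) => h _; case: (h (sndI l)).
    + by move=> i s; rewrite /pairin /pairout !ixE.
    + by move=> i s t; rewrite /pairin /pairout !ixE.
  exact: (li_comp hM hN).
move=> x y x' y' k k' M f _ hM.
have -> : (fun i : 'I_k' => ext_std m1 m2 (fun X => \sum_(j < k | f j == i) M j X)) =
    (fun i X => \sum_(j < k | f j == i) ext_std m1 m2 (M j) X).
  by apply/funext=> i; apply/funext=> X; rewrite /ext_std liftmap_sum.
exact: li_coarse.
Qed.

Lemma locc_ext m1 m2 x y x' y' (L : mapT R (x * y) (x' * y')) :
  locc L -> locc (ext_std m1 m2 L).
Proof.
move=> [k [M [hM /funext->]]]; exists k, (fun j => ext_std m1 m2 (M j)); split.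
  exact: locc_instr_ext.
by move=> X; rewrite /ext_std liftmap_sum.
Qed.

(** Each [regroup] hypothesis supplies relabellings on one side of the cut; the lift is [ext_std]
    between these local relabellings. *)
Lemma locc_liftmap p q x x' p' q' y y' (u : 'I_p -> 'I_x -> 'I_q) (v : 'I_p -> 'I_x')
    (u' : 'I_p' -> 'I_y -> 'I_q') (v' : 'I_p' -> 'I_y') (L : mapT R (x * y) (x' * y')) :
  regroup u v -> regroup u' v' -> locc L -> locc (liftmap (pairin u u') (pairout v v') L).
Proof.
move=> [m [f [g [hf hg hv hu]]]] [m' [f' [g' [hf' hg' hv' hu']]]] hL.
have -> : liftmap (pairin u u') (pairout v v') L =
    fun X => reix (pairout f f') (ext_std m m' L (reix (pairout g g') X)).
  apply/funext=> X; rewrite /ext_std liftmap_reix reix_liftmap.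
  by congr (_ X); apply: eq_liftmap => [i s|i]; rewrite /pairin /pairout !ixE ?hu ?hu' ?hv ?hv'.
apply: locc_comp; first exact: locc_reix.
by apply: locc_comp; [apply: locc_ext|apply: locc_reix].
Qed.

(** Alice draws [j] with probability [p j], prepares [s j] and announces [j]; Bob then prepares
    [w j]. The weight is put into Alice's branch, and the factor 1 in [k * 1] is Bob's single
    outcome. *)
Lemma locc_prep m n x y (rho : 'M[C]_(x * y)) : separable rho ->
  locc (fun X : 'M[C]_(m * n) => bten X rho).
Proof.
move=> [k [p [s [w [hp [sp [hs [hw ->]]]]]]]].
pose E j (X : 'M[C]_m) := tensat (@fstI m x) sndI X ((p j)%:C%C *: s j).
pose F j (X : 'M[C]_n) := tensat (@fstI n y) sndI X (w j).
have bij a b : bijective (fun i : 'I_(a * b) => ix (fstI i) (sndI i)).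
  by exists id => i; rewrite !ixE.
exists (k * 1)%N, (fun l X => mapten id (F (fstI l)) (mapten (E (fstI l)) id X)); split.
  apply: (@li_comp R m n (m * x) n (m * x) (n * y) k 1 (fun j => mapten (E j) id)
     (fun j _ => mapten id (F j))).
    apply: li_alice; split=> [j|X].
      by apply/cp_tensat/psdZ; [rewrite ler0c|case: (hs j)].
    rewrite raddf_sum /=; under eq_bigr => j _.
      rewrite mxtrace_tensat // linearZ /=; have [_ ->] := hs j; rewrite mulr1.
      over.
    by rewrite -mulr_sumr -(rmorph_sum (real_complex R)) sp rmorph1 mulr1.
  move=> j; apply: (@li_bob R (m * x) n (n * y) 1 (fun=> F j)); split=> [_|X].
    by apply: cp_tensat; case: (hw j).
  by rewrite big_ord1 mxtrace_tensat //; have [_ ->] := hw j; rewrite mulr1.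
move=> X; apply/matrixP=> i j; rewrite !summxE sum_ix mxE !summxE mulr_sumr.
apply: eq_bigr => a _; rewrite big_ord1 ixE mapten_idl mapten_idr !liftmap_map_tensat !mxE.
by rewrite -!/(fstI _) -!/(sndI _) !ixE !mulrA.
Qed.

Definition ptr a m (X : 'M[C]_(a * m)) : 'M[C]_a := \sum_u reix (fun i => ix i u) X.

Lemma cptp_ptr a m : cptp (@ptr a m).
Proof.
split; first by apply: cp_sum => u _; apply: cp_reix.
move=> X; rewrite /ptr raddf_sum /= /mxtrace sum_ix exchange_big /=.
by apply: eq_bigr => u _; apply: eq_bigr => i _; rewrite mxE.
Qed.

Lemma locc_ptr a b m1 m2 : locc (fun X : 'M[C]_((a * m1) * (b * m2)) =>
  \sum_u \sum_v reix (fun i => ix (ix (fstI i) u) (ix (sndI i) v)) X).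
Proof.
have -> : (fun X : 'M[C]_((a * m1) * (b * m2)) =>
    \sum_u \sum_v reix (fun i => ix (ix (fstI i) u) (ix (sndI i) v)) X) =
    fun X => mapten id (@ptr b m2) (mapten (@ptr a m1) id X).
  apply/funext=> X; rewrite mapten_idl mapten_idr /ptr !liftmap_sum exchange_big /=.
  apply: eq_bigr => v _; rewrite liftmap_map_reix linmap_sum; last exact: linmap_reix.
  apply: eq_bigr => u _; rewrite liftmap_map_reix reix_comp; congr (_ X).
  by apply: eq_reix => i; rewrite /= !ixE.
by apply: locc_comp; [apply/locc_bob/cptp_ptr|apply/locc_alice/cptp_ptr].
Qed.

End Locc.

Arguments ext_std {R} m1 m2 {x y x' y'} L X.

(** * Ingredients of sequential codes *)

Section Codes.

Variable R : realType.
Local Notation C := (R[i]).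
Local Notation idt k F := (@idten R k _ _ F).

(* tele_simulable only speaks of states, but a simulated channel acts on a part
   of a larger system, hence on arbitrary matrices. *)
Lemma linmap_eq_states m n (F G : mapT R m n) : linmap F -> linmap G ->
  (forall rho, state rho -> F rho = G rho) -> F = G.
Proof.
move=> lF lG h.
have hP P : psd P -> F P = G P.
  (* A positive matrix of trace zero cannot be normalised to a state, but it is zero. *)
  move=> hP; have [t0|t0] := eqVneq (\tr P) 0.
    by rewrite (psd_trace0 hP t0) !linmap0.
  have -> : P = \tr P *: ((\tr P)^-1 *: P) by rewrite scalerA divff // scale1r.
  rewrite [LHS]linmapZ // [RHS]linmapZ // h //; split.
    by apply: psdZ => //; rewrite invr_ge0 psd_trace_ge0.
  by rewrite linearZ /= mulVf.
have hH X : adjmx X = X -> F X = G X.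
  by move=> /herm_jordan[P [Q [pP pQ -> _]]]; rewrite !linmapB // !hP.
apply/funext=> X.
(* Cartesian decomposition: [X = (H1 + 'i H2) / 2] with both parts Hermitian. *)
pose H1 := X + adjmx X; pose H2 := (- 'i) *: (X - adjmx X).
have e1 : adjmx H1 = H1 by rewrite /H1 adjmxD adjmxK addrC.
have e2 : adjmx H2 = H2.
  by rewrite /H2 adjmxZ adjmxB adjmxK rmorphN /= conjCi opprK scaleNr -scalerN opprB.
have -> : X = 2^-1 *: (H1 + 'i *: H2).
  rewrite /H2 scalerA mulrN -expr2 sqrCi opprK scale1r /H1 addrACA subrr addr0.
  by rewrite -mulr2n -(scaler_nat _ X) scalerA mulVf ?pnatr_eq0 // scale1r.
rewrite (linmapZ _ _ lF) (linmapZ _ _ lG) (linmapD _ _ lF) (linmapD _ _ lG).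
by rewrite (linmapZ _ _ lF) (linmapZ _ _ lG) (hH _ e1) (hH _ e2).
Qed.

Lemma trnormN n (X : 'M[C]_n) : trnorm (- X) = trnorm X.
Proof.
have e : adjmx (- X) = - adjmx X by rewrite -scaleN1r adjmxZ rmorphN1 scaleN1r.
by rewrite /trnorm e mulmxN mulNmx opprK.
Qed.

Lemma trnorm_contract_psd m n (F : mapT R m n) A B : ptp F -> psd A -> psd B ->
  trnorm (F A - F B) <= trnorm (A - B).
Proof.
move=> hF hA hB; have [lF _ _] := hF; rewrite -linmapB //.
by apply: trnorm_contract; rewrite // adjmxB !psd_herm.
Qed.

Lemma ptp_comp m n p (F : mapT R n p) (G : mapT R m n) : ptp F -> ptp G ->
  ptp (fun X => F (G X)).
Proof.
move=> [lF pF tF] [lG pG tG]; split; [exact: linmap_comp| |exact: tp_comp].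
by move=> X /pG/pF.
Qed.

Lemma cptp_ptp m n (F : mapT R m n) : cptp F -> ptp F.
Proof. by move=> [cF tF]; split=> // [|X]; [case: cF|apply: cp_psd]. Qed.

Lemma ptp_liftmap p q x x' (u : 'I_p -> 'I_x -> 'I_q) (v : 'I_p -> 'I_x') (F : mapT R x x') :
  regroup u v -> cptp F -> ptp (liftmap u v F).
Proof. by move=> ? ?; apply/cptp_ptp/cptp_liftmap. Qed.

Lemma ptp_idten k x x' (F : mapT R x x') : cptp F -> ptp (idt k F).
Proof. by rewrite idtenE; apply/ptp_liftmap/regroup_std. Qed.

Lemma idten_comp k x y z (F : mapT R y z) (G : mapT R x y) X : linmap F ->
  idt k (fun Y => F (G Y)) X = idt k F (idt k G X).
Proof.
by move=> hF; rewrite !idtenE; apply/esym/liftmap_comp => // [i s|i s t]; rewrite !ixE.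
Qed.

Lemma tensatC p q r (f : 'I_p -> 'I_q) (g : 'I_p -> 'I_r) (X : 'M[C]_q) (Y : 'M[C]_r) :
  tensat f g X Y = tensat g f Y X.
Proof. by apply/matrixP=> i j; rewrite !mxE mulrC. Qed.

(** A map confined to one tensor factor: [f] does not see the index [s] that [F] acts on, so [X]
    comes out as a common factor. *)
Lemma liftmap_tensat p q q1 q2 x x' p2 (u : 'I_p -> 'I_x -> 'I_q) (v : 'I_p -> 'I_x')
    (f : 'I_q -> 'I_q1) (g : 'I_q -> 'I_q2) (f' : 'I_p -> 'I_q1) (g' : 'I_p -> 'I_p2)
    (u' : 'I_p2 -> 'I_x -> 'I_q2) (v' : 'I_p2 -> 'I_x') (F : mapT R x x') X Y :
  (forall i s, f (u i s) = f' i) -> (forall i s, g (u i s) = u' (g' i) s) ->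
  (forall i, v i = v' (g' i)) ->
  liftmap u v F (tensat f g X Y) = tensat f' g' X (liftmap u' v' F Y).
Proof.
move=> hf hg hv; apply/matrixP=> i j; rewrite !mxE mulr_sumr.
by apply: eq_bigr => s _; rewrite mxE !hf !hg !hv mulrA.
Qed.

Lemma liftmap_tensat_r p q q1 x x' (u : 'I_p -> 'I_x -> 'I_q) (v : 'I_p -> 'I_x')
    (f : 'I_q -> 'I_q1) (g : 'I_q -> 'I_x) (f' : 'I_p -> 'I_q1) (F : mapT R x x') X Y :
  linmap F -> (forall i s, f (u i s) = f' i) -> (forall i s, g (u i s) = s) ->
  liftmap u v F (tensat f g X Y) = tensat f' v X (F Y).
Proof. by move=> lF hf hg; rewrite (liftmap1 _ lF); apply: liftmap_tensat. Qed.

Lemma liftmap_pre_tensat p q x x' y r (u : 'I_p -> 'I_x -> 'I_q) (v : 'I_p -> 'I_x')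
    (f : 'I_y -> 'I_r) (g : 'I_y -> 'I_x) (F : mapT R y x') T X i j :
  linmap F ->
  liftmap u v (fun Z => F (tensat f g T Z)) X i j =
  \sum_s T (f s.1) (f s.2) * X (u i (g s.1)) (u j (g s.2)) *
    F (delta_mx s.1 s.2) (v i) (v j).
Proof.
move=> lF; rewrite mxE.
under eq_bigr => t _.
  rewrite (linmap_delta (tensat _ _ _ _)) // mulr_sumr.
  under eq_bigr => s _ do rewrite mxE mulrA mulrCA.
  over.
rewrite exchange_big /=; apply: eq_bigr => s _; rewrite -mulr_suml -mulr_sumr.
by rewrite (sum_delta (fun t => X (u i t.1) (u j t.2))).
Qed.

Lemma attachE r a' b' m1 m2 (rho : 'M[C]_(r * (a' * b'))) (Phi : 'M[C]_(m1 * m2)) :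
  attach rho Phi =
  tensat (fun i => ix (fstI i) (ix (fstI (fstI (sndI i))) (fstI (sndI (sndI i)))))
        (fun i => ix (sndI (fstI (sndI i))) (sndI (sndI (sndI i)))) rho Phi.
Proof. by []. Qed.

Lemma ptp_attach r a' b' m1 m2 (rho : 'M[C]_(r * (a' * b'))) : state rho ->
  ptp (fun Phi : 'M[C]_(m1 * m2) => attach rho Phi).
Proof.
move=> [pr tr]; split=> [c X Y|X hX|X].
- by rewrite !attachE !(tensatC _ _ rho) linmap_tensat.
- exact: psd_tensat.
rewrite attachE mxtrace_tensat ?tr ?mul1r //.
exists (fun k => ix (fstI (fstI k))
  (ix (ix (fstI (sndI (fstI k))) (fstI (sndI k))) (ix (sndI (sndI (fstI k))) (sndI (sndI k))))).
  by move=> i; rewrite !ixE.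
by move=> i; rewrite !ixE.
Qed.

Lemma idten_ext_attach r a' b' m1 m2 m1' m2' (F : mapT R (m1 * m2) (m1' * m2'))
    (rho : 'M[C]_(r * (a' * b'))) Phi : linmap F ->
  idt r (ext_std a' b' F) (attach rho Phi) = attach rho (F Phi).
Proof.
move=> lF; rewrite idtenE /ext_std liftmap_liftmap !attachE.
by apply: liftmap_tensat_r => // i s; rewrite /pairin !ixE.
Qed.

Lemma apply_mem_attach r r' a b a' b' m1 m2
    (F : mapT R (r * (a * b)) (r' * (a' * b'))) rho (Phi : 'M[C]_(m1 * m2)) :
  linmap F -> apply_mem F (attach rho Phi) = attach (F rho) Phi.
Proof.
move=> lF; rewrite apply_memE !attachE ![tensat _ _ _ Phi]tensatC.
by apply: liftmap_tensat_r => // i s; rewrite !ixE.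
Qed.

Lemma ptp_apply_mem r r' a b a' b' m1 m2 (F : mapT R (r * (a * b)) (r' * (a' * b'))) :
  cptp F -> ptp (@apply_mem R r r' a b a' b' m1 m2 F).
Proof.
move=> hF; rewrite apply_memE; apply: ptp_liftmap => //.
(* [f] and [g] exhibit the pair of memories as the idle factor [m1 * m2] required by [regroup]. *)
pose f (i : 'I_(r' * ((a' * m1) * (b' * m2)))) :=
  ix (ix (sndI (fstI (sndI i))) (sndI (sndI (sndI i))))
     (ix (fstI i) (ix (fstI (fstI (sndI i))) (fstI (sndI (sndI i))))).
pose g c d e (k : 'I_((m1 * m2) * (c * (d * e)))) :=
  ix (fstI (sndI k)) (ix (ix (fstI (sndI (sndI k))) (fstI (fstI k)))
     (ix (sndI (sndI (sndI k))) (sndI (fstI k)))).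
exists (m1 * m2)%N, f, (@g r a b); rewrite /f /g; split=> [||i|i s]; rewrite ?ixE //.
  by exists (@g r' a' b') => i; rewrite /g !ixE.
exists (fun i => ix (ix (sndI (fstI (sndI i))) (sndI (sndI (sndI i))))
     (ix (fstI i) (ix (fstI (fstI (sndI i))) (fstI (sndI (sndI i))))));
  by move=> i; rewrite !ixE.
Qed.

Lemma trmemE r a b m1 m2 (X : 'M[C]_(r * ((a * m1) * (b * m2)))) :
  trmem X = \sum_u \sum_v
    reix (fun i => ix (fstI i) (ix (ix (fstI (sndI i)) u) (ix (sndI (sndI i)) v))) X.
Proof.
apply/matrixP=> i j; rewrite mxE summxE; apply: eq_bigr => u _.
by rewrite summxE; apply: eq_bigr => v _; rewrite mxE.
Qed.

Lemma ptp_trmem r a b m1 m2 : ptp (@trmem R r a b m1 m2).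
Proof.
apply: cptp_ptp; split.
  have -> : @trmem R r a b m1 m2 = fun X => \sum_u \sum_v
    reix (fun i => ix (fstI i) (ix (ix (fstI (sndI i)) u) (ix (sndI (sndI i)) v))) X.
    by apply/funext=> X; exact: trmemE.
  by apply: cp_sum => u _; apply: cp_sum => v _; apply: cp_reix.
move=> X; rewrite /mxtrace !sum_ix; apply: eq_bigr => c _; rewrite !sum_ix.
apply: eq_bigr => i _.
under [LHS]eq_bigr => j _ do rewrite mxE !ixE.
under [RHS]eq_bigr => u _ do rewrite sum_ix.
rewrite exchange_big /=; apply: eq_bigr => u _.
by apply: eq_bigr => v _.
Qed.

Lemma trmem_attach r a b m1 m2 (rho : 'M[C]_(r * (a * b))) (Phi : 'M[C]_(m1 * m2)) :
  \tr Phi = 1 -> trmem (attach rho Phi) = rho.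
Proof.
move=> tP; apply/matrixP=> i j; rewrite mxE -[RHS]mulr1 -tP /mxtrace sum_ix mulr_sumr.
apply: eq_bigr => u _; rewrite mulr_sumr; apply: eq_bigr => v _.
by rewrite mxE !ixE.
Qed.

Lemma psd_maxent M : psd (maxent R M).
Proof.
pose B : 'M[C]_(1, M * M) := \row_i (fstI i == sndI i)%:R.
suff -> : maxent R M = (M%:R)^-1 *: (adjmx B *m B).
  by apply: psdZ; [rewrite invr_ge0|apply: psd_gram].
apply/matrixP=> i j; rewrite !mxE big_ord1 adjmxE !mxE rmorph_nat.
by case: (_ == _); case: (_ == _); rewrite /= ?mulr0 ?mul0r ?mulr0 ?mulr1.
Qed.

Lemma state_tpow la lb (th : 'M[C]_(la * lb)) n : state th -> state (tpow th n).
Proof.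
move=> [pth tth]; elim: n => [|n [IHp IHt]] /=.
  have -> : const_mx 1 = 1%:M :> 'M[C]_(1 * 1).
    by apply/matrixP=> i j; rewrite !mxE !ord1.
  by split; [apply: psd1|rewrite mxtrace1].
split; first exact: psd_tensat.
rewrite btenE mxtrace_tensat ?IHt ?tth ?mulr1 //.
exists (fun k => ix (ix (fstI (fstI k)) (fstI (sndI k))) (ix (sndI (fstI k)) (sndI (sndI k)))).
  by move=> i; rewrite !ixE.
by move=> i; rewrite !ixE.
Qed.

End Codes.

(** * From state codes to channel codes *)

Section StateToChannel.

Variable R : realType.
Local Notation C := (R[i]).
Local Notation idt k F := (@idten R k _ _ F).

Variables (a' b' a b la lb : nat).
Variables (N : mapT R (a' * b') (a * b)) (th : 'M[C]_(la * lb)).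
Variable T : mapT R ((la * a') * (lb * b')) (a * b).

(** One party's share: [l] is the newest resource copy, consumed together with the channel input
    [x]; [p] holds the remaining copies. *)
Definition tele_in p l x y (i : 'I_(y * p)) (s : 'I_(l * x)) : 'I_(x * (p * l)) :=
  ix (sndI s) (ix (sndI i) (fstI s)).

Lemma regroup_tele p l x y : regroup (@tele_in p l x y) (@fstI y p).
Proof.
exists p, (@ixswap y p),
  (fun k : 'I_(p * (l * x)) => ix (sndI (sndI k)) (ix (fstI k) (fstI (sndI k)))).
split=> [||i|i s]; rewrite /ixswap /tele_in ?ixE //; first exact: bij_ixswap.
by exists (fun i => ix (fstI (sndI i)) (ix (sndI (sndI i)) (fstI i))) => i; rewrite !ixE.
Qed.

(** Spends one of [m] stored copies. The value at 0 is a filler: the [n] uses start with [n], ..., 1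
    copies. *)
Definition tele_step m : mapT R ((a' * pdim la m) * (b' * pdim lb m))
    ((a * pdim la m.-1) * (b * pdim lb m.-1)) :=
  match m with
  | 0 => fun=> 0
  | m'.+1 => liftmap (pairin (@tele_in (pdim la m') la a' a) (@tele_in (pdim lb m') lb b' b))
                  (pairout fstI fstI) T
  end.

(* The memory dimensions use iter i predn n instead of n - i: the successor
   index is then convertible to the predecessor dimension produced by
   tele_step. *)
Definition tele_code M n (Lam : mapT R (M * M) (pdim la n * pdim lb n)) i :
    mapT R ((a' * mdim M (fun j => pdim la (iter j predn n)) i)
            * (b' * mdim M (fun j => pdim lb (iter j predn n)) i))
           ((a * mdim M (fun j => pdim la (iter j predn n)) i.+1)
            * (b * mdim M (fun j => pdim lb (iter j predn n)) i.+1)) :=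
  match i with
  | 0 => fun X => @tele_step n (ext_std a' b' Lam X)
  | i'.+1 => @tele_step (iter i'.+1 predn n)
  end.

Hypotheses (lT : locc T) (NE : N = fun X => T (bten th X)) (sth : state th).

Lemma locc_tele_step m : (0 < m)%N -> locc (@tele_step m).
Proof.
by case: m => // m _; apply: locc_liftmap => //; apply: regroup_tele.
Qed.

Lemma linmap_tele_step m : linmap (@tele_step m).
Proof.
by case: m => [|m] c X Y /=; [rewrite scaler0 addr0|apply: linmap_liftmap].
Qed.

(** With an exact copy the step reproduces [N] without error and leaves the other copies in product
    form, ready for the next use. *)
Lemma tele_step_attach m r (rho : 'M[C]_(r * (a' * b'))) : (0 < m)%N ->
  idt r (@tele_step m) (attach rho (tpow th m)) = attach (idt r N rho) (tpow th m.-1).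
Proof.
have linT : linmap T by have [[]] := locc_cptp lT.
case: m => // m _; rewrite /= idtenE liftmap_liftmap NE; apply/matrixP=> i j.
rewrite [RHS]mxE idtenE btenE liftmap_pre_tensat // mxE mulr_suml.
apply: eq_bigr => s _; rewrite !mxE /pairin /pairout /tele_in !ixE.
rewrite [RHS]mulrAC; congr (_ * _); rewrite [RHS]mulrAC [LHS]mulrC; congr (_ * _).
by rewrite mulrC.
Qed.

Lemma iter_predn i n : iter i predn n = (n - i)%N.
Proof. by elim: i => [|i IH]; rewrite ?subn0 // iterS IH subnS. Qed.

(** One and the same map [G] of the resource yields the simulated run at [Lam (maxent R M)] and the
    ideal run, with the unspent copies, at [tpow th n]. This reduces the comparison of runs to one
    of resources. *)
Lemma sim_tele M n (Lam : mapT R (M * M) (pdim la n * pdim lb n)) r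
    (rho0 : 'M[C]_(r 0 * (a' * b')))
    (Adv : forall k, mapT R (r k * (a * b)) (r k.+1 * (a' * b'))) k :
  locc Lam -> state rho0 -> (forall k, (k < n.-1)%N -> cptp (Adv k)) -> (k < n)%N ->
  exists G : mapT R (pdim la n * pdim lb n)
     (r k * ((a * pdim la (iter k.+1 predn n)) * (b * pdim lb (iter k.+1 predn n)))),
  [/\ ptp G, sim_st (tele_code Lam) rho0 Adv k = G (Lam (maxent R M))
    & G (tpow th n) = attach (real_st N rho0 Adv k) (tpow th (iter k.+1 predn n))].
Proof.
move=> lLam hrho hAdv; have linLam : linmap Lam by have [[]] := locc_cptp lLam.
elim: k => [|k IH] hk.
  exists (fun X => idt (r 0) (@tele_step n) (attach rho0 X)); split.
  - apply: ptp_comp; last exact: ptp_attach.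
    by apply/ptp_idten/locc_cptp/locc_tele_step.
  - rewrite /= (@idten_comp R (r 0) _ _ _ (@tele_step n) (ext_std a' b' Lam)).
      by rewrite idten_ext_attach.
    exact: linmap_tele_step.
  by rewrite tele_step_attach.
have hm : (0 < iter k.+1 predn n)%N by rewrite iter_predn subn_gt0.
have cA : cptp (Adv k) by apply: hAdv; case: (n) hk.
have [G [pG sG tG]] := IH (ltnW hk).
exists (fun X => idt (r k.+1) (@tele_step (iter k.+1 predn n)) (apply_mem (Adv k) (G X))).
split.
- apply: ptp_comp; first by apply/ptp_idten/locc_cptp/locc_tele_step.
  by apply: ptp_comp => //; apply: ptp_apply_mem.
- by rewrite -sG.
rewrite tG apply_mem_attach; last by case: cA => -[].
by rewrite tele_step_attach.
Qed.

Lemma achievable_state_channel rt : achievable_state th rt -> achievable_channel N rt.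
Proof.
move=> ach eps heps delta hdelta; have [n0 hn0] := ach eps heps delta hdelta.
exists n0 => n hn n_gt0; have [M [M_gt0 [hM [Lam [lLam hLam]]]]] := hn0 n hn.
exists M; split=> //; split=> //.
exists (fun j => pdim la (iter j predn n)), (fun j => pdim lb (iter j predn n)), (tele_code Lam).
split=> [i hi|r rho0 Adv hrho hAdv].
  case: i hi => [|i] hi /=.
    by apply: locc_comp; [exact: locc_tele_step|exact: locc_ext].
  by apply: (@locc_tele_step (iter i.+1 predn n)); rewrite iter_predn subn_gt0.
apply: le_trans hLam; rewrite ler_pM2r ?invr_gt0 ?ltr0n //.
have hk : (n.-1 < n)%N by rewrite prednK.
have [G [pG -> tG]] := sim_tele lLam hrho hAdv hk.
(* Unspent copies have trace 1, so the true final state is [trmem (G (tpow th n))], and contraction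
   applies to [trmem] after [G]. *)
rewrite -[X in X - _](trmem_attach (real_st N rho0 Adv n.-1)
  (proj2 (state_tpow (iter n.-1.+1 predn n) sth))) -tG.
rewrite -[leRHS]trnormN opprB.
apply: (trnorm_contract_psd (F := fun X => trmem (G X))).
- by apply: ptp_comp => //; apply: ptp_trmem.
- by case: (state_tpow n sth).
by apply: cp_psd; [case: (locc_cptp lLam)|apply: psd_maxent].
Qed.

End StateToChannel.

(** * From channel codes to state codes *)

(** Passes between the strategy's order, reference [p * q] first and channel systems [s * t] last,
    and the order along the cut, Alice's [p * s] against Bob's [q * t]. *)
Definition ixmid p q s t (i : 'I_((p * q) * (s * t))) : 'I_((p * s) * (q * t)) :=
  ix (ix (fstI (fstI i)) (fstI (sndI i))) (ix (sndI (fstI i)) (sndI (sndI i))).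

Lemma ixmidK p q s t : cancel (@ixmid p q s t) (@ixmid p s q t).
Proof. by move=> i; rewrite /ixmid !ixE. Qed.

Lemma bij_ixmid p q s t : bijective (@ixmid p q s t).
Proof. by exists (@ixmid p s q t); apply: ixmidK. Qed.

Section ChannelToState.

Variable R : realType.
Local Notation C := (R[i]).
Local Notation idt k F := (@idten R k _ _ F).

Lemma reix_ixmidK p q s t (X : 'M[C]_((p * s) * (q * t))) :
  reix (@ixmid p s q t) (reix (@ixmid p q s t) X) = X.
Proof. by rewrite reix_comp; apply: reix_id => i /=; exact: ixmidK. Qed.

Lemma idten_ixmid p q x y x' y' (L : mapT R (x * y) (x' * y')) X :
  idt (p * q) L (reix (@ixmid p q x y) X) = reix (@ixmid p q x' y') (ext_std p q L X).
Proof.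
rewrite idtenE liftmap_reix reix_liftmap; congr (_ X).
by apply: eq_liftmap => [i s|i]; rewrite /ixmid /pairin /pairout !ixE.
Qed.

Lemma bij_assoc p q r : bijective
  (fun i : 'I_((p * q) * r) => ix (fstI (fstI i)) (ix (sndI (fstI i)) (sndI i))).
Proof.
by exists (fun i => ix (ix (fstI i) (fstI (sndI i))) (sndI (sndI i))) => i; rewrite !ixE.
Qed.

Definition discard_mem p q a b m1 m2 (X : 'M[C]_((p * (a * m1)) * (q * (b * m2)))) :
    'M[C]_((p * a) * (q * b)) :=
  \sum_u \sum_v reix (fun i => ix (ix (fstI i) u) (ix (sndI i) v))
    (reix (pairout (fun i : 'I_((p * a) * m1) => ix (fstI (fstI i)) (ix (sndI (fstI i)) (sndI i)))
              (fun i : 'I_((q * b) * m2) => ix (fstI (fstI i)) (ix (sndI (fstI i)) (sndI i))))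
        X).

Lemma locc_discard_mem p q a b m1 m2 : locc (@discard_mem p q a b m1 m2).
Proof. exact: locc_comp (locc_ptr _ _ _ _ _) (locc_reix _ (bij_assoc _ _ _) (bij_assoc _ _ _)). Qed.

Lemma trmem_ixmid p q a b m1 m2 (X : 'M[C]_((p * (a * m1)) * (q * (b * m2)))) :
  trmem (reix (@ixmid p q (a * m1) (b * m2)) X) = reix (@ixmid p q a b) (discard_mem X).
Proof.
rewrite trmemE linmap_sum; last exact: linmap_reix.
apply: eq_bigr => u _; rewrite linmap_sum; last exact: linmap_reix.
apply: eq_bigr => v _; rewrite !reix_comp; congr (_ X).
by apply: eq_reix => i; rewrite /= /ixmid /pairout !ixE.
Qed.

Definition mem_in m r x r' x' (i : 'I_(r' * (x' * m))) (s : 'I_(r * x)) : 'I_(r * (x * m)) :=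
  ix (fstI s) (ix (sndI s) (sndI (sndI i))).

Definition mem_out m r' x' (i : 'I_(r' * (x' * m))) : 'I_(r' * x') :=
  ix (fstI i) (fstI (sndI i)).

Lemma regroup_mem m r x r' x' : regroup (@mem_in m r x r' x') (@mem_out m r' x').
Proof.
exists m, (fun i => ix (sndI (sndI i)) (ix (fstI i) (fstI (sndI i)))),
  (fun k => ix (fstI (sndI k)) (ix (sndI (sndI k)) (fstI k))).
split=> [||i|i s]; rewrite /mem_in /mem_out ?ixE //.
  by exists (fun k => ix (fstI (sndI k)) (ix (sndI (sndI k)) (fstI k))) => i; rewrite !ixE.
by exists (fun i => ix (sndI (sndI i)) (ix (fstI i) (fstI (sndI i)))) => i; rewrite !ixE.
Qed.

(** Along the cut, an adversary of this form acts as a lift of [G] with each party's memory idle, so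
    it is LOCC whenever [G] is. *)
Lemma apply_mem_ixmid p q a b p' q' a' b' m1 m2
    (G : mapT R ((p * a) * (q * b)) ((p' * a') * (q' * b'))) X : linmap G ->
  apply_mem (fun Y => reix (@ixmid p' q' a' b') (G (reix (@ixmid p a q b) Y)))
    (reix (@ixmid p q (a * m1) (b * m2)) X) =
  reix (@ixmid p' q' (a' * m1) (b' * m2))
    (liftmap (pairin (@mem_in m1 p a p' a') (@mem_in m2 q b q' b'))
          (pairout (@mem_out m1 p' a') (@mem_out m2 q' b')) G X).
Proof.
move=> lG; rewrite apply_memE liftmap_sandwich // liftmap_reix reix_liftmap; congr (_ X).
by apply: eq_liftmap => [i s|i]; rewrite /ixmid /pairin /pairout /mem_in /mem_out !ixE.
Qed.

(** * The seizing adversary *)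

Variables (a' b' a b la lb : nat).
Variables (N : mapT R (a' * b') (a * b)) (th : 'M[C]_(la * lb)).
Variables (am bm : nat) (rho : 'M[C]_((am * a') * (b' * bm))).
Variable D : mapT R ((am * a) * (b * bm)) (la * lb).
Hypotheses (cN : cptp N) (srho : separable rho) (lD : locc D).
Hypotheses (De : D (apply_mid N rho) = th) (sth : state th).

Definition prep m n (X : 'M[C]_(m * n)) : 'M[C]_(((m * am) * a') * ((n * bm) * b')) :=
  reix (pairout (fun i => ix (fstI (fstI i)) (ix (sndI (fstI i)) (sndI i)))
           (fun i => ix (fstI (fstI i)) (ix (sndI i) (sndI (fstI i)))))
     (bten X rho).

Lemma locc_prep_probe m n : locc (@prep m n).
Proof.
apply: locc_comp (locc_prep _ _ srho); apply: locc_reix; first exact: bij_assoc.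
by exists (fun i => ix (ix (fstI i) (sndI (sndI i))) (fstI (sndI i))) => i; rewrite !ixE.
Qed.

Definition seize m n : mapT R (((m * am) * a) * ((n * bm) * b)) ((m * la) * (n * lb)) :=
  liftmap (pairin (fun (i : 'I_(m * la)) (s : 'I_(am * a)) => ix (ix (fstI i) (fstI s)) (sndI s))
             (fun (i : 'I_(n * lb)) (s : 'I_(b * bm)) => ix (ix (fstI i) (sndI s)) (fstI s)))
       (pairout sndI sndI) D.

Lemma locc_seize m n : locc (@seize m n).
Proof.
apply: locc_liftmap => //.
  exists m, id, (fun k => ix (ix (fstI k) (fstI (sndI k))) (sndI (sndI k))).
  split=> // [||i s]; rewrite ?ixE //; first exact: bij_id.
  by exists (fun i => ix (fstI (fstI i)) (ix (sndI (fstI i)) (sndI i))) => i; rewrite !ixE.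
exists n, id, (fun k => ix (ix (fstI k) (sndI (sndI k))) (fstI (sndI k))).
split=> // [||i s]; rewrite ?ixE //; first exact: bij_id.
by exists (fun i => ix (fstI (fstI i)) (ix (sndI i) (sndI (fstI i)))) => i; rewrite !ixE.
Qed.

(** One round of the adversary: the stored [X] is a spectator while the probe passes through [N] and
    [D] turns it into one more copy of [th]. *)
Lemma seize_prep m n (X : 'M[C]_(m * n)) :
  seize (ext_std (m * am) (n * bm) N (prep X)) = bten X th.
Proof.
have lDl : linmap D by have [[]] := locc_cptp lD.
have -> : ext_std (m * am) (n * bm) N (prep X) =
  tensat (fun i => ix (fstI (fstI (fstI i))) (fstI (fstI (sndI i))))
        (fun i => ix (ix (sndI (fstI (fstI i))) (sndI (fstI i)))
                     (ix (sndI (sndI i)) (sndI (fstI (sndI i))))) X (apply_mid N rho).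
  rewrite /ext_std liftmap_reix apply_midE btenE.
  by apply: liftmap_tensat => [i s|i s|i]; rewrite /pairin /pairout !ixE.
rewrite /seize -De btenE.
by apply: liftmap_tensat_r => // i s; rewrite /pairin !ixE.
Qed.

Definition probe_dim k := ((pdim la k * am) * (pdim lb k * bm))%N.

Definition probe : 'M[C]_(probe_dim 0 * (a' * b')) := reix (@ixmid _ _ a' b') (prep (tpow th 0)).

(** The reference at step [k] holds [k] seized copies and the probe's ancillas; the copy from the
    current use is seized before a fresh probe is prepared. *)
Definition seizing_adv k : mapT R (probe_dim k * (a * b)) (probe_dim k.+1 * (a' * b')) :=
  fun X => reix (@ixmid (pdim la k.+1 * am) (pdim lb k.+1 * bm) a' b')
    (prep (@seize (pdim la k) (pdim lb k) (reix (@ixmid (pdim la k * am) a (pdim lb k * bm) b) X))).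

Lemma locc_prep_seize k :
  locc (fun X => @prep (pdim la k.+1) (pdim lb k.+1) (@seize (pdim la k) (pdim lb k) X)).
Proof. by apply: locc_comp; [exact: locc_prep_probe|exact: locc_seize]. Qed.

Lemma cptp_seizing_adv k : cptp (@seizing_adv k).
Proof.
apply: cptp_comp; first by apply/cptp_reix/bij_ixmid.
apply: (@cptp_comp _ _ _ _ (fun X => prep (seize X))); last by apply/cptp_reix/bij_ixmid.
exact: locc_cptp (@locc_prep_seize k).
Qed.

Lemma state_probe : state probe.
Proof.
have [p0 t0] := state_tpow 0 sth; have [cP tP] := locc_cptp (@locc_prep_probe 1 1).
split; first exact: psd_reix (cp_psd cP p0).
by rewrite tp_reix ?tP //; apply: bij_ixmid.
Qed.

Lemma real_seizing k : real_st N probe seizing_adv k =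
  reix (@ixmid (pdim la k * am) (pdim lb k * bm) a b) (ext_std _ _ N (prep (tpow th k))).
Proof.
elim: k => [|k IH]; first exact: idten_ixmid.
by rewrite /= IH /seizing_adv reix_ixmidK seize_prep; exact: idten_ixmid.
Qed.

(** Probing, seizing and the code's own maps are all LOCC along the cut, so the simulated run is a
    single LOCC map [K] of the maximally entangled state. *)
Lemma sim_seizing M n (ma mb : nat -> nat)
    (L : forall i, mapT R ((a' * mdim M ma i) * (b' * mdim M mb i))
                          ((a * mdim M ma i.+1) * (b * mdim M mb i.+1))) k :
  (forall i, (i < n)%N -> locc (L i)) -> (k < n)%N ->
  exists K : mapT R (M * M) (((pdim la k * am) * (a * mdim M ma k.+1))
                             * ((pdim lb k * bm) * (b * mdim M mb k.+1))),
    locc K /\ sim_st L probe seizing_adv k = reix (@ixmid _ _ _ _) (K (maxent R M)).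
Proof.
move=> hL; elim: k => [|k IH] hk.
  (* The initial memory is the maximally entangled state itself. [f] and [g] order it and the probe
     as [L 0] expects; the factor 1 is the empty tensor power. *)
  pose f (i : 'I_((1 * am) * (a' * M))) : 'I_(M * (am * a')) :=
    ix (sndI (sndI i)) (ix (sndI (fstI i)) (fstI (sndI i))).
  pose g (i : 'I_((1 * bm) * (b' * M))) : 'I_(M * (b' * bm)) :=
    ix (sndI (sndI i)) (ix (fstI (sndI i)) (sndI (fstI i))).
  have bf : bijective f.
    exists (fun k => ix (ix ord0 (fstI (sndI k))) (ix (sndI (sndI k)) (fstI k))) => i.
      have e : fstI (fstI i) = ord0 by exact: ord1.
      by rewrite /f !ixE -e !ixE.
    by rewrite /f !ixE.
  have bg : bijective g.
    exists (fun k => ix (ix ord0 (sndI (sndI k))) (ix (fstI (sndI k)) (fstI k))) => i.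
      have e : fstI (fstI i) = ord0 by exact: ord1.
      by rewrite /g !ixE -e !ixE.
    by rewrite /g !ixE.
  exists (fun X => ext_std (1 * am) (1 * bm) (L 0) (reix (pairout f g) (bten X rho))); split.
    apply: locc_comp; first exact: locc_ext (hL 0 hk).
    by apply: locc_comp; [exact: locc_reix|exact: locc_prep].
  rewrite /= -idten_ixmid; congr (idten _ _).
  apply/matrixP=> i j; rewrite !mxE /= /ixmid /pairout /f /g !ixE.
  by rewrite mul1r mulrC.
have [K [lK sK]] := IH (ltnW hk).
exists (fun X => ext_std (pdim la k.+1 * am) (pdim lb k.+1 * bm) (L k.+1)
  (liftmap (pairin (@mem_in (mdim M ma k.+1) (pdim la k * am) a (pdim la k.+1 * am) a')
              (@mem_in (mdim M mb k.+1) (pdim lb k * bm) b (pdim lb k.+1 * bm) b'))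
        (pairout (@mem_out _ _ _) (@mem_out _ _ _))
        (fun X => @prep (pdim la k.+1) (pdim lb k.+1) (@seize (pdim la k) (pdim lb k) X))
     (K X))); split.
  apply: locc_comp; first exact: locc_ext (hL _ hk).
  apply: (@locc_comp _ _ _ _ _ _ _ (liftmap _ _ _)) => //.
  by apply: locc_liftmap; [exact: regroup_mem|exact: regroup_mem|exact: locc_prep_seize].
rewrite -idten_ixmid -apply_mem_ixmid -?sK //.
by have [[]] := locc_cptp (@locc_prep_seize k).
Qed.

Lemma achievable_channel_state rt : achievable_channel N rt -> achievable_state th rt.
Proof.
move=> ach eps heps delta hdelta; have [n0 hn0] := ach eps heps delta hdelta.
(* Channel codes are only provided for [n >= 1], hence the maximum with 1. *)
exists (maxn n0 1) => n; rewrite geq_max => /andP[hn n_gt0].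
have [M [hM [M_gt0 [ma [mb [L [lL hL]]]]]]] := hn0 n hn n_gt0.
exists M; split=> //; split=> //.
(* There are now [n.+1] uses, the last of index [n]: the reference then holds [n] copies, and a
   final [seize] supplies the last one. *)
case: n n_gt0 lL hL {hn hM} => // n _ lL hL.
have [K [lK sK]] := sim_seizing lL (ltnSn n).
have {hL} := hL probe_dim probe seizing_adv state_probe (fun k _ => cptp_seizing_adv k).
rewrite /= real_seizing sK trmem_ixmid => hP.
have lP := locc_comp (@locc_discard_mem _ _ _ _ _ _) lK.
exists (fun X => @seize (pdim la n) (pdim lb n) (discard_mem (K X))).
split; first exact: (locc_comp (locc_seize _ _) lP).
apply: le_trans hP; rewrite ler_pM2r ?invr_gt0 ?ltr0n //.
(* The target is written as the final [seize] applied to the true final state, so both terms are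
   images of the two final states under one channel and contraction applies. *)
rewrite -[X in _ - X](seize_prep (tpow th n)).
rewrite -[leLHS]trnormN opprB.
rewrite -[X in seize X - _](reix_ixmidK (ext_std _ _ N _)).
rewrite -[X in _ - seize X](reix_ixmidK (discard_mem _)).
apply: (trnorm_contract_psd
  (F := fun X => @seize (pdim la n) (pdim lb n) (reix (@ixmid _ _ _ _) X))).
- by apply/cptp_ptp/cptp_comp; [exact: locc_cptp (locc_seize _ _)|apply/cptp_reix/bij_ixmid].
- apply: psd_reix; apply: psd_liftmap; first by case: cN.
  apply: (cp_psd (proj1 (locc_cptp (@locc_prep_probe _ _)))).
  by case: (state_tpow n sth).
by apply: psd_reix; apply: (cp_psd (proj1 (locc_cptp lP))); apply: psd_maxent.
Qed.

End ChannelToState.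

Unset Implicit Arguments.

Theorem theorem1 (R : realType) (a' b' a b la lb : nat)
  (N : mapT R (a' * b') (a * b)) (theta : 'M[R[i]]_(la * lb)) :
  cptp N -> state theta ->
  tele_simulable N theta -> resource_seizable N theta ->
  EC_channel N = EC_state theta.
Proof.
move=> cN sth [T [lT eT]] [am [bm [rho [D [srho [lD De]]]]]].
(* Teleportation simulation is upgraded from states to all matrices, so that it also holds on part
   of a larger system. *)
have NE : N = fun X => T (bten theta X).
  apply: linmap_eq_states => //; first by case: cN => -[].
  apply: linmap_comp; first by have [[]] := locc_cptp lT.
  by move=> c X Y; rewrite !btenE !(tensatC _ _ theta) linmap_tensat.
rewrite /EC_channel /EC_state.
suff -> : ([set rt | achievable_channel N rt] = [set rt | achievable_state theta rt])%classic
  by [].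
apply/seteqP; split=> rt /=.
  exact: (achievable_channel_state cN srho lD De sth).
exact: (achievable_state_channel lT NE sth).
Qed.
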